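(* Let $\nu>0$, $0<T<\infty$, and let $u$ be a Leray-Hopf solution on $[0,T]$ of the 3D Navier-Stokes equations $\partial_t u-\nu\Delta u+(u\cdot\nabla)u+\nabla p=0$, $\nabla\cdot u=0$ on $\mathbb{R}^3$. Then its dissipation wavenumber $\Lambda(t)$, defined in the context, satisfies $\Lambda\in L^1(0,T)$.
   Context: Weak solution: for divergence-free $u_0\in L^2(\mathbb{R}^3)$, a weak solution on $[0,T]$ with initial data $u_0$ is a vector field $u\in C_{\mathrm w}([0,T];L^2(\mathbb{R}^3))$ (weakly continuous in time) with $u(0)=u_0$, $\nabla_x\cdot u(t)=0$ in the sense of distributions for all $t\in[0,T]$, and $$(u(t),\varphi(t))-(u_0,\varphi(0))=\int_0^t\{(u(s),\partial_s\varphi(s))+\nu(u(s),\Delta\varphi(s))+(u(s)\cdot\nabla\varphi(s),u(s))\}\,ds$$ for all $t\in[0,T]$ and all vector-valued test functions $\varphi\in C_0^\infty([0,T]\times\mathbb{R}^3)$ with $\nabla_x\cdot\varphi=0$, where $(\cdot,\cdot)$ is the $L^2$ inner product. Leray-Hopf solution ($\nu>0$): a weak solution with $u\in L^2([0,T];H^1(\mathbb{R}^3))$ satisfying $\|u(t)\|_2^2+2\nu\int_{t_0}^t\|\nabla u(s)\|_2^2\,ds\le\|u(t_0)\|_2^2$ for almost all $t_0\in(0,T)$ and all $t\in(t_0,T]$. Littlewood-Paley notation: $\lambda_q=2^q$. Fix a nonnegative radial $\chi\in C_0^\infty(B_1)$, $B_1\subset\mathbb{R}^3$ the unit ball centered at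 $0$, with $\chi(\xi)=1$ for $|\xi|\le 1/2$; $\varphi(\xi)=\chi(\xi/2)-\chi(\xi)$, $\varphi_q(\xi)=\varphi(2^{-q}\xi)$. For a tempered distribution $u$: $u_q=\mathcal F^{-1}(\varphi_q)*u$ for $q\ge0$, $u_{-1}=\mathcal F^{-1}(\chi)*u$. Dissipation wavenumber: with $c_0>0$ a fixed absolute constant, $\Lambda(t)=\min\{\lambda_q:\ q\ge0,\ \lambda_p^{-1}\|u_p(t)\|_\infty<c_0\nu\ \text{ for all } p>q\}$, with $\Lambda(t)=\infty$ if no such $q$ exists. *)

(* Defs.v *)
From HB Require Import structures.
From mathcomp Require Import all_boot all_order all_algebra.
From mathcomp Require Import all_classical all_reals all_analysis.
From mathcomp Require Import complex.

Set Implicit Arguments.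
Unset Strict Implicit.
Unset Printing Implicit Defensive.

Import Order.TTheory GRing.Theory Num.Theory.
Import numFieldNormedType.Exports.

Local Open Scope classical_set_scope.
Local Open Scope ring_scope.
Local Open Scope complex_scope.

Notation R3 R := (R * R * R)%type.

Section euclidean_space.
Context (R : realType).

Definition coord3 (i : 'I_3) (x : R3 R) : R := nth 0 [:: x.1.1; x.1.2; x.2] i.

Definition basis_vec (i : 'I_3) : R3 R :=
  (((i == 0 :> nat)%:R, (i == 1 :> nat)%:R), (i == 2 :> nat)%:R).

Definition dot3 (x y : R3 R) : R := \sum_(i < 3) coord3 i x * coord3 i y.

(* The library norm on a product is the max norm; it induces the same topology
   but is not the Euclidean length. *)
Definition enorm (x : R3 R) : R := Num.sqrt (dot3 x x).

End euclidean_space.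

Lemma sigma_finite_product d1 d2 (T1 : measurableType d1)
    (T2 : measurableType d2) (R : realType)
    (m1 : {sigma_finite_measure set T1 -> \bar R})
    (m2 : {sigma_finite_measure set T2 -> \bar R}) :
  sigma_finite setT (m1 \x m2)%E.
Proof.
have /sigma_finiteP[F [TF ndF Foo]] := sigma_finiteT m1.
have /sigma_finiteP[G [TG ndG Goo]] := sigma_finiteT m2.
exists (fun n => F n `*` G n).
  rewrite -setXTT TF TG predeqE => -[x y]; split.
    move=> [/= [n _ Fnx] [k _ Gky]]; exists (maxn n k) => //; split.
    - by move: x Fnx; exact/subsetPset/ndF/leq_maxl.
    - by move: y Gky; exact/subsetPset/ndG/leq_maxr.
  by move=> [n _ []/= ? ?]; split; exists n.
move=> k; have [? ?] := Foo k; have [? ?] := Goo k.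
split; first exact: measurableX.
by rewrite product_measure1E// lte_mul_pinfty// ge0_fin_numE.
Qed.

(* The library's canonical sigma-finite instance on products is only found for
   finite factors, hence the named measures carrying explicit instances. *)
Definition lebesgue_measure2 (R : realType) :
    set (measurableTypeR R * measurableTypeR R) -> \bar R :=
  (@lebesgue_measure R \x @lebesgue_measure R)%E.

HB.instance Definition _ (R : realType) := Measure.copy (@lebesgue_measure2 R)
  (@lebesgue_measure R \x @lebesgue_measure R)%E.

HB.instance Definition _ (R : realType) :=
  Measure_isSigmaFinite.Build _ _ _ (@lebesgue_measure2 R)
    (sigma_finite_product (@lebesgue_measure R) (@lebesgue_measure R)).

Definition lebesgue_measure3 (R : realType) :
    set (measurableTypeR R * measurableTypeR R * measurableTypeR R) -> \bar R :=
  (@lebesgue_measure2 R \x @lebesgue_measure R)%E.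

HB.instance Definition _ (R : realType) := Measure.copy (@lebesgue_measure3 R)
  (@lebesgue_measure2 R \x @lebesgue_measure R)%E.

HB.instance Definition _ (R : realType) :=
  Measure_isSigmaFinite.Build _ _ _ (@lebesgue_measure3 R)
    (sigma_finite_product (@lebesgue_measure2 R) (@lebesgue_measure R)).

Section test_functions.
Context (R : realType) (V : normedModType R).

Fixpoint iter_derive (s : seq V) (f : V -> R) : V -> R :=
  if s is v :: s' then 'D_v (iter_derive s' f) else f.

(* C^infty (V finite-dimensional): all iterated directional derivatives exist
   and are continuous. *)
Definition smooth (f : V -> R) : Prop :=
  forall s : seq V, continuous (iter_derive s f) /\
    forall x v, derivable (iter_derive s f) x v.

Definition fun_supp (f : V -> R) : set V := closure [set x | f x != 0].

Definition test_function (f : V -> R) : Prop :=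
  smooth f /\ compact (fun_supp f).

End test_functions.

Section vector_fields.
Context (R : realType).
Local Notation mu3 := (@lebesgue_measure3 R).
Implicit Types (i j : 'I_3) (f g psi : R3 R -> R).

Definition partial i f : R3 R -> R := 'D_(basis_vec R i) f.

Definition laplacian f : R3 R -> R :=
  fun x => \sum_(j < 3) partial j (partial j f) x.

Definition L2fun f : Prop := f \in Lfun mu3 2%:E.

Definition L2field (I : finType) (v : I -> R3 R -> R) : Prop :=
  forall k : I, L2fun (v k).

Definition l2_inner (v w : 'I_3 -> R3 R -> R) : R :=
  \sum_(i < 3) \int[mu3]_x (v i x * w i x).

Definition l2_norm (I : finType) (v : I -> R3 R -> R) : \bar R :=
  Lnorm mu3 2%:E (fun x => (Num.sqrt (\sum_(k : I) v k x ^+ 2))%:E).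

Definition div_free_distr (v : 'I_3 -> R3 R -> R) : Prop :=
  forall psi, test_function psi ->
    \sum_(i < 3) \int[mu3]_x (v i x * partial i psi x) = 0.

Definition is_weak_partial i f g : Prop :=
  L2fun g /\ forall psi, test_function psi ->
    \int[mu3]_x (f x * partial i psi x) = - \int[mu3]_x (g x * psi x).

Definition H1fun f : Prop :=
  L2fun f /\ forall i, exists g, is_weak_partial i f g.

(* A representative of the weak derivative (unique up to null sets) when it
   exists, and 0 otherwise. *)
Definition weak_partial i f : R3 R -> R :=
  xget (fun=> 0) [set g | is_weak_partial i f g].

Definition weak_grad (v : 'I_3 -> R3 R -> R) :
    'I_3 * 'I_3 -> R3 R -> R :=
  fun ij => weak_partial ij.2 (v ij.1).

Definition H1field (v : 'I_3 -> R3 R -> R) : Prop := forall i, H1fun (v i).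

Definition h1_norm_sq (v : 'I_3 -> R3 R -> R) : \bar R :=
  (l2_norm v ^+ 2 + l2_norm (weak_grad v) ^+ 2)%E.

End vector_fields.

Section navier_stokes.
Context (R : realType).
Local Notation leb := (@lebesgue_measure R).
Implicit Types (nu T t s : R) (u : R -> 'I_3 -> R3 R -> R).

Definition weakly_continuous T u : Prop :=
  (forall t, t \in `[0, T] -> L2field (u t)) /\
  forall w, L2field w ->
    {within `[0, T], continuous (fun t => l2_inner (u t) w)}.

Implicit Type phi : 'I_3 -> R * R3 R -> R.

Definition slice phi s : 'I_3 -> R3 R -> R := fun i x => phi i (s, x).

Definition dt phi s : 'I_3 -> R3 R -> R :=
  fun i x => 'D_((1, (0, 0, 0)) : R * R3 R) (phi i) (s, x).

(* Elements of C_0^infty([0,T] x R^3), smooth up to t = 0 and t = T, are the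
   restrictions of compactly supported smooth functions on R x R^3; they need
   not vanish at t = 0 or t = T.  Only the values on [0,T] x R^3 enter, and
   the divergence is only required to vanish there. *)
Definition solenoidal_test T phi : Prop :=
  (forall i, test_function (phi i)) /\
  forall s x, s \in `[0, T] -> \sum_(i < 3) partial i (slice phi s i) x = 0.

Definition weak_form_integrand nu u phi s : R :=
  l2_inner (u s) (dt phi s)
  + nu * l2_inner (u s) (fun i => laplacian (slice phi s i))
  + l2_inner (fun i x => \sum_(j < 3) u s j x * partial j (slice phi s i) x)
             (u s).

Definition weak_solution nu T (u0 : 'I_3 -> R3 R -> R) u : Prop :=
  [/\ L2field u0 /\ div_free_distr u0,
      weakly_continuous T u,
      forall i, {ae @lebesgue_measure3 R, forall x, u 0 i x = u0 i x},
      forall t, t \in `[0, T] -> div_free_distr (u t) &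
      forall phi, solenoidal_test T phi -> forall t, t \in `[0, T] ->
        l2_inner (u t) (slice phi t) - l2_inner u0 (slice phi 0) =
        \int[leb]_(s in `[0, t]) weak_form_integrand nu u phi s].

(* For a weakly continuous u, strong measurability into the separable space H^1
   is automatic, so integrability of the squared norm is all that remains. *)
Definition L2_in_time_H1 T u : Prop :=
  {ae leb, forall t, t \in `[0, T] -> H1field (u t)} /\
  leb.-integrable `[0, T] (fun t => h1_norm_sq (u t)).

Definition leray_hopf nu T (u0 : 'I_3 -> R3 R -> R) u : Prop :=
  [/\ weak_solution nu T u0 u,
      L2_in_time_H1 T u &
      {ae leb, forall t0, t0 \in `]0, T[ -> forall t, t \in `]t0, T] ->
        (l2_norm (u t) ^+ 2
         + (2 * nu)%:E
           * \int[leb]_(s in `[t0, t]) l2_norm (weak_grad (u s)) ^+ 2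
         <= l2_norm (u t0) ^+ 2)%E}].

End navier_stokes.

Section littlewood_paley.
Context (R : realType).
Local Notation mu3 := (@lebesgue_measure3 R).

Definition complex_integral (g : R3 R -> R[i]) : R[i] :=
  (\int[mu3]_x complex.Re (g x)) +i* (\int[mu3]_x complex.Im (g x)).

Definition expi (theta : R) : R[i] := cos theta +i* sin theta.

(* Normalised so that the Fourier transform is
   \int f(x) exp(- i x . xi) dx. *)
Definition inv_fourier (f : R3 R -> R[i]) : R3 R -> R[i] :=
  fun x => (((2 * pi) ^+ 3)^-1)%:C
           * complex_integral (fun xi => f xi * expi (dot3 x xi)).

Definition convolution (f g : R3 R -> R[i]) : R3 R -> R[i] :=
  fun x => complex_integral (fun y => f (x - y) * g y).

Definition lp_cutoff (chi : R3 R -> R) : Prop :=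
  [/\ test_function chi,
      fun_supp chi `<=` [set xi | enorm xi < 1],
      forall xi, 0 <= chi xi,
      forall xi eta, enorm xi = enorm eta -> chi xi = chi eta &
      forall xi, enorm xi <= 2^-1 -> chi xi = 1].

Definition lambda (q : nat) : R := 2 ^+ q.

Definition lp_phi (chi : R3 R -> R) (q : nat) : R3 R -> R :=
  let phi xi := chi (2^-1 *: xi) - chi xi in
  fun xi => phi ((lambda q)^-1 *: xi).

(* u_q for q >= 0, componentwise; for real u it is real, but this is a theorem
   rather than part of the definition. *)
Definition lp_proj (chi : R3 R -> R) (q : nat) (v : 'I_3 -> R3 R -> R) :
    'I_3 -> R3 R -> R[i] :=
  fun i => convolution (inv_fourier (fun xi => (lp_phi chi q xi)%:C))
                       (fun y => (v i y)%:C).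

Definition linf_norm (v : 'I_3 -> R3 R -> R[i]) : \bar R :=
  Lnorm mu3 +oo%E
    (fun x =>
      (Num.sqrt (\sum_(i < 3) ComplexField.Normc.normc (v i x) ^+ 2))%:E).

(* The infimum of a nonempty set of powers lambda q is attained, and the
   infimum of the empty set is +oo. *)
Definition dissipation_wavenumber (chi : R3 R -> R) (c0 nu : R)
    (v : 'I_3 -> R3 R -> R) : \bar R :=
  ereal_inf [set (lambda q)%:E | q in [set q : nat |
    forall p : nat, (q < p)%N ->
      (((lambda p)^-1)%:E * linf_norm (lp_proj chi p v) < (c0 * nu)%:E)%E]].

End littlewood_paley.

(* Main.v *)
Require Import Defs.
From HB Require Import structures.
From mathcomp Require Import all_boot all_order all_algebra.
From mathcomp Require Import all_classical all_reals all_analysis.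
From mathcomp Require Import measurable_realfun ess_sup_inf complex ring lra.

(* If [X < lambda_p] with [X = C |grad u(t)|_2^2 / (c0 nu)^2], then the Bernstein
   bound [|u_p|_oo^2 <= C lambda_p |grad u|_2^2] gives
   [lambda_p^-1 |u_p|_oo < c0 nu].  Hence [Lambda(t) <= 1 + X] for almost every
   [t], which is integrable because [u] is in [L^2 H^1].  The Bernstein bound
   follows from [u_p = sum_j G_j * d_j u] and Cauchy-Schwarz, [G_j] having the
   frequency profile [- i xi_j phi_p / |xi|^2].  Measurability of [Lambda] comes
   from the weak continuity of [u], which makes [t |-> u_p(t, x)] continuous. *)

Set Implicit Arguments.
Unset Strict Implicit.
Unset Printing Implicit Defensive.

Import Order.TTheory GRing.Theory Num.Theory.
Import numFieldNormedType.Exports.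

Local Open Scope classical_set_scope.
Local Open Scope ring_scope.

(** * Borel sets and affine maps of the three-dimensional space *)

(* [R] carries two convertible measurable structures; this is the one on which
   [lebesgue_measure3] is declared. *)
Local Notation M3 R := (measurableTypeR R * measurableTypeR R * measurableTypeR R)%type.

(** All that is needed of [G_j] is that its squared [L^2] norm is [lambda_p] times a constant
    independent of [p]. This is computed in physical space: the profile is homogeneous of degree -1
    up to the cutoff, so the kernel is [lambda^2 G(lambda x)] with [G] the kernel for [p = 0], and
    the square integrates to [lambda^(4 - 3)] times that of [G]. The latter is finite because three
    integrations by parts, one per coordinate, give enough decay. Three obstacles shape the rest.
    The division by [|xi|^2] is singular at the origin, where the cutoff vanishes; the denominator
    is modified there. Weak derivatives are tested against compactly supported functions, which the
    kernels are not, so moving the derivative between kernel and field takes a truncation and a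
    limit. Finally [Lambda] is defined by essential suprema, while the Bernstein bound and weak
    continuity concern values at points; continuity of [u_p(t)] in space identifies the two. Complex
    kernels are treated as pairs of real integrals of [h(xi) cos(x . xi - a)], the phase [a] keeping
    track of the factors [i]. *)

Section borel3.
Context (R : realType).

Lemma open_measurable3 (A : set (R3 R)) : open A -> measurable (A : set (M3 R)).
Proof.
move=> oA.
pose box (p : rat * rat * rat * rat) : set (R3 R) :=
  (ball (ratr p.1.1.1 : R) (ratr p.2 : R) `*` ball (ratr p.1.1.2 : R) (ratr p.2 : R))
    `*` ball (ratr p.1.2 : R) (ratr p.2 : R).
have -> : A = \bigcup_p (if `[< box p `<=` A >] then box p else set0).
  apply/seteqP; split => [x Ax|x [p _]]; last first.
    by case: ifPn => // /asboolP + bx; apply.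
  have [e /= e0 eA] : \forall e \near 0^'+, ball x e `<=` A by exact: open_subball.
  (* Two points of a box of radius [r < e / 4] are within [e / 2] of each other, so a small rational
     box containing [x] stays in [A]. *)
  have [r /andP[r0 re]] : exists r : rat, 0 < (ratr r : R) < e / 4.
    have /rat_in_itvoo[r] : 0 < e / 4 by rewrite divr_gt0.
    by rewrite in_itv /= => h; exists r.
  have H (y : R) : exists c : rat, ball (ratr c : R) (ratr r : R) y.
    have /rat_in_itvoo[c] : y < y + ratr r by rewrite ltrDl.
    rewrite in_itv /= => /andP[yc cy]; exists c.
    by rewrite /ball /= gtr0_norm ?subr_gt0// ltrBlDl.
  have [c1 h1] := H x.1.1; have [c2 h2] := H x.1.2; have [c3 h3] := H x.2.
  exists (c1, c2, c3, r) => //.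
  rewrite asboolT; first by split; first split.
  move=> y [[/= y1 y2] y3].
  apply: (eA (e / 2)) => /=. 
  - by rewrite sub0r normrN gtr0_norm ?divr_gt0// ltr_pdivrMr// ltr_pMr// ltr1n.
  - by rewrite divr_gt0.
  have L (a b c : R) : ball c (ratr r : R) a -> ball c (ratr r : R) b ->
      ball a (e / 2) b.
    rewrite /ball /= => ha hb.
    have -> : a - b = (c - b) - (c - a) by lra.
    by rewrite (le_lt_trans (ler_normB _ _))//; lra.
  split; [split|].
  - exact: L h1 y1.
  - exact: L h2 y2.
  - exact: L h3 y3.
apply: countable_bigcupT_measurable => [|p]; first exact: countableP.
case: ifPn => // _; apply: measurableX; first apply: measurableX.
- exact: measurable_ball.
- exact: measurable_ball.
- exact: measurable_ball.
Qed.

Lemma continuous_measurable3 (f : R3 R -> R) :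
  continuous f -> measurable_fun (setT : set (M3 R)) f.
Proof.
move=> cf; apply: (measurability _ (RGenOInfty.measurableE R)) ; move=> _ [_ [a ->] <-].
rewrite setTI; apply: open_measurable3.
by move/continuousP : cf; apply; exact: rray_open.
Qed.

End borel3.

Section affine.
Context (R : realType).

(** Change of variables stated on preimages of sets: for [y |-> a + c y] in dimension three, [k] is
    [|c|^-3]. *)
Definition dilates d (T : measurableType d) (m : {measure set T -> \bar R})
    (k : R) (f : T -> T) :=
  measurable_fun setT f /\
  forall A, measurable A -> m (f @^-1` A) = (k%:E * m A)%E.

(** Divided by [k1 k2], the pushforward of the product measure agrees with that measure on
    rectangles, hence everywhere by uniqueness. *)
Lemma dilates_prod d1 d2 (T1 : measurableType d1) (T2 : measurableType d2)
    (m1 : {sigma_finite_measure set T1 -> \bar R})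
    (m2 : {sigma_finite_measure set T2 -> \bar R}) (k1 k2 : R) f1 f2 :
  0 < k1 -> 0 < k2 -> dilates m1 k1 f1 -> dilates m2 k2 f2 ->
  dilates (m1 \x m2)%E (k1 * k2) (fun x => (f1 x.1, f2 x.2)).
Proof.
move=> k10 k20 [mf1 H1] [mf2 H2].
set F := (fun x => _).
have mF : measurable_fun setT F.
  apply: measurable_fun_pair.
    exact: measurableT_comp mf1 measurable_fst.
  exact: measurableT_comp mf2 measurable_snd.
split=> // A mA.
have k0 : 0 <= (k1 * k2)^-1 by rewrite invr_ge0 mulr_ge0// ltW.
have step B C : measurable B -> measurable C ->
    (((k1 * k2)^-1)%:E * (m1 \x m2) (F @^-1` (B `*` C)) = m1 B * m2 C)%E.
  move=> mB mC.
  have -> : F @^-1` (B `*` C) = (f1 @^-1` B) `*` (f2 @^-1` C) by [].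
  rewrite product_measure1E//; last 2 first.
  - by rewrite -[_ @^-1` _]setTI; exact: mf1.
  - by rewrite -[_ @^-1` _]setTI; exact: mf2.
  rewrite H1// H2// muleACA -EFinM !muleA -EFinM mulVf ?mul1e//.
  by rewrite mulf_neq0// gt_eqF.
have E := @product_measure_unique _ _ _ _ _ m1 m2
  (mscale (NngNum k0) (pushforward (m1 \x m2)%E F)) step A mA.
transitivity ((k1 * k2)%:E * ((k1 * k2)^-1%:E * (m1 \x m2) (F @^-1` A)))%E.
  by rewrite muleA -EFinM divff ?mul1e// mulf_neq0// gt_eqF.
by congr (_ * _)%E; exact: esym (E mF).
Qed.

(** The pushforward multiplied by [|c|] gives half-open intervals their length, which characterises
    Lebesgue measure. *)
Lemma dilates_lebesgue1 (a c : R) : c != 0 ->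
  dilates (@lebesgue_measure R) `|c|^-1 (fun y : measurableTypeR R => a + c * y).
Proof.
move=> c0.
set F : measurableTypeR R -> measurableTypeR R := (fun y => _).
have mF : measurable_fun setT F.
  apply: continuous_measurable_fun => x.
  by apply: cvgD; [exact: cvg_cst|apply: cvgM; [exact: cvg_cst|exact: cvg_id]].
split=> // A mA.
have k0 : 0 <= `|c| by [].
have step X : ocitv X -> lebesgue_measure X = (`|c|%:E * lebesgue_measure (F @^-1` X))%E.
  move=> [[u v] _ <-] /=.
  have [cp|cn|/eqP] := ltgtP c 0; last by rewrite (negbTE c0).
    (* A negative slope reverses the interval, so the closed end is now on the left. *)
    have -> : F @^-1` `]u, v] = `[((v - a) / c), ((u - a) / c)[%classic.
      apply/seteqP; split => y /=; rewrite /F !in_itv /= ler_ndivrMr// ltr_ndivlMr//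
        [y * c]mulrC.
        by move=> /andP[? ?]; apply/andP; split; lra.
      by move=> /andP[? ?]; apply/andP; split; lra.
    rewrite !lebesgue_measure_itv /= !lte_fin ltr_nM2r ?invr_lt0//.
    rewrite ltrD2r; case: ifPn => _; last by rewrite mule0.
    rewrite -EFinM ltr0_norm//; congr EFin; field.
    exact: c0.
  have -> : F @^-1` `]u, v] = `]((u - a) / c), ((v - a) / c)]%classic.
    apply/seteqP; split => y /=; rewrite /F !in_itv /= ler_pdivlMr// ltr_pdivrMr//
      [y * c]mulrC.
      by move=> /andP[? ?]; apply/andP; split; lra.
    by move=> /andP[? ?]; apply/andP; split; lra.
  rewrite !lebesgue_measure_itv /= !lte_fin ltr_pM2r ?invr_gt0//.
  rewrite ltrD2r; case: ifPn => _; last by rewrite mule0.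
  rewrite -EFinM gtr0_norm//; congr EFin; field.
  exact: c0.
have E := @lebesgue_measure_unique _
  (mscale (NngNum k0) (pushforward (@lebesgue_measure R) F)) step A mA.
transitivity (`|c|^-1%:E * (`|c|%:E * (lebesgue_measure (F @^-1` A))))%E.
  by rewrite muleA -EFinM mulVf ?mul1e// normr_eq0.
by congr (_ * _)%E; exact: esym (E mF).
Qed.

Definition aff (a : R3 R) (c : R) (y : R3 R) : R3 R := a + c *: y.

Local Notation mu3 := (@lebesgue_measure3 R).

Lemma dilates_lebesgue3 (a : R3 R) (c : R) : c != 0 ->
  dilates mu3 (`|c|^-1 ^+ 3) (aff a c).
Proof.
move=> c0; have cp : 0 < `|c|^-1 by rewrite invr_gt0 normr_gt0.
have H2 : dilates (@lebesgue_measure2 R) (`|c|^-1 * `|c|^-1)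
    (fun x => (a.1.1 + c * x.1, a.1.2 + c * x.2)).
  exact: (dilates_prod cp cp
    (dilates_lebesgue1 a.1.1 c0) (dilates_lebesgue1 a.1.2 c0)).
rewrite (_ : _ ^+ 3 = `|c|^-1 * `|c|^-1 * `|c|^-1); last first.
  by rewrite !exprS expr0 mulr1 mulrA.
exact: (dilates_prod (mulr_gt0 cp cp) cp H2 (dilates_lebesgue1 a.2 c0)).
Qed.

Section transfer.
Context d (T : measurableType d) (m : {measure set T -> \bar R}).
Local Open Scope ereal_scope.

Lemma dilates_integral (k : R) (F : T -> T) (f : T -> \bar R) :
  (0 < k)%R -> dilates m k F -> measurable_fun setT f ->
  (forall x, 0 <= f x) ->
  \int[m]_x f (F x) = k%:E * \int[m]_x f x.
Proof.
move=> k0 [mF HF] mf f0.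
have := @ge0_integral_pushforward _ _ _ _ _ _ mF m setT f measurableT mf
  (fun y _ => f0 y).
rewrite preimage_setT /comp => <-.
have k0' : (0 <= k)%R by exact: ltW.
rewrite -[k%:E]/((NngNum k0')%:num%:E) -ge0_integral_mscale//.
by apply: eq_measure_integral => A mA _; rewrite -[LHS]/(m (F @^-1` A)) HF.
Qed.

Lemma dilates_integrable (k : R) (F : T -> T) (f : T -> R) :
  (0 < k)%R -> dilates m k F ->
  m.-integrable setT (EFin \o f) -> m.-integrable setT (EFin \o (f \o F)).
Proof.
move=> k0 dF /integrableP[mf fi]; apply/integrableP; split.
  by apply: (measurableT_comp mf); case: dF.
rewrite (@dilates_integral k F (fun x => `|(EFin \o f) x|))//.
  by rewrite lte_mul_pinfty// ltW.
exact: measurableT_comp.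
Qed.

Lemma dilates_Rintegral (k : R) (F : T -> T) (f : T -> R) :
  (0 < k)%R -> dilates m k F -> measurable_fun setT f ->
  (\int[m]_x f (F x) = k * \int[m]_x f x)%R.
Proof.
move=> k0 dF mf.
have /measurable_EFinP mf' := mf.
rewrite /Rintegral integralE [in RHS]integralE.
set g := EFin \o f.
have e1 x : (fun x => (f (F x))%:E)^\+%E x = g^\+%E (F x) by rewrite !funeposE.
have e2 x : (fun x => (f (F x))%:E)^\-%E x = g^\-%E (F x) by rewrite !funenegE.
have -> : (\int[m]_x (fun x => (f (F x))%:E)^\+ x = k%:E * \int[m]_x g^\+ x)%E.
  rewrite -(dilates_integral k0 dF)//; first by apply: eq_integral => x _; exact: e1.
  exact: measurable_funepos.
have -> : (\int[m]_x (fun x => (f (F x))%:E)^\- x = k%:E * \int[m]_x g^\- x)%E.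
  rewrite -(dilates_integral k0 dF)//; first by apply: eq_integral => x _; exact: e2.
  exact: measurable_funeneg.
have kE : (0 < k%:E)%E by rewrite lte_fin.
(* No integrability is assumed: multiplying by [k > 0] preserves infinite parts, and [fine] then
   sends both sides to 0. *)
case: (\int[m]_x g^\+ x)%E => [p| |]; case: (\int[m]_x g^\- x)%E => [q| |];
  rewrite ?gt0_muley ?gt0_muleNy ?mulr0//=.
by rewrite mulrBr.
Qed.

End transfer.
End affine.

(** * Smooth functions *)

Section smooth_calculus.
Context (R : realType) (V : normedModType R).
Implicit Types (f g : V -> R) (n : nat).

(** [smooth] graded by order, so that products and inverses can be handled by induction: their
    derivatives involve the original functions at one order less. *)
Fixpoint Cn n f : Prop :=
  continuous f /\
  if n is m.+1 then (forall x v, derivable f x v) /\ forall v, Cn m ('D_v f)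
  else True.

Lemma Cn_continuous n f : Cn n f -> continuous f.
Proof. by case: n => [|n] []. Qed.

Lemma CnW n f : Cn n.+1 f -> Cn n f.
Proof.
elim: n f => [|n IH] f; first by case.
by case=> cf [df Hf]; split=> //; split => // v; exact: IH.
Qed.

Lemma iter_derive_rcons s v f :
  iter_derive (rcons s v) f = iter_derive s ('D_v f).
Proof. by elim: s => //= w s ->. Qed.

Lemma smooth_derive f v : smooth f -> smooth ('D_v f).
Proof. by move=> sf s; rewrite -iter_derive_rcons; exact: sf. Qed.

(** [Cn] differentiates [f] itself first, whereas [iter_derive] applies the head of its list last;
    hence the induction from the end of the list. *)
Lemma smoothP f : smooth f <-> forall n, Cn n f.
Proof.
split=> [sf n|Cf s].
  elim: n f sf => [|n IH] f sf; have [cf df] := sf [::]; split => //.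
  by split => // v; exact/IH/smooth_derive.
elim/last_ind: s f Cf => [|s v IH] f Cf.
  by have [? []] := Cf 1%N.
by rewrite iter_derive_rcons; apply: IH => n; have [_ [_]] := Cf n.+1; apply.
Qed.

Lemma Cn_cst n (a : R) : Cn n (cst a).
Proof.
elim: n a => [|n IH] a; split=> //; try exact: cst_continuous.
split=> [x v|v]; first exact: derivable_cst.
by rewrite (_ : 'D_v (cst a) = cst 0)//; apply/funext => x; rewrite derive_cst.
Qed.

Lemma CnD n f g : Cn n f -> Cn n g -> Cn n (f \+ g).
Proof.
elim: n f g => [|n IH] f g [cf Cf] [cg Cg].
  by split=> // x; apply: cvgD; [exact: cf|exact: cg].
have [[df Df] [dg Dg]] := (Cf, Cg).
split; first by move=> x; apply: cvgD; [exact: cf|exact: cg].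
split=> [x v|v]; first by apply: derivableD.
rewrite (_ : 'D_v (f \+ g) = 'D_v f \+ 'D_v g); last first.
  by apply/funext => x; rewrite deriveD.
by apply: IH; [exact: Df|exact: Dg].
Qed.

Lemma CnM n f g : Cn n f -> Cn n g -> Cn n (f \* g).
Proof.
elim: n f g => [|n IH] f g Hf Hg; have [cf Cf] := Hf; have [cg Cg] := Hg.
  by split=> // x; apply: cvgM; [exact: cf|exact: cg].
have [[df Df] [dg Dg]] := (Cf, Cg).
split; first by move=> x; apply: cvgM; [exact: cf|exact: cg].
split=> [x v|v]; first by apply: derivableM.
rewrite (_ : 'D_v (f \* g) = (f \* 'D_v g) \+ (g \* 'D_v f)); last first.
  by apply/funext => x; rewrite deriveM.
by apply: CnD; apply: IH; [exact: CnW|exact: Dg|exact: CnW|exact: Df].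
Qed.

Lemma CnZ n (a : R) f : Cn n f -> Cn n (fun x => a * f x).
Proof. by move=> Cf; apply: (@CnM n (cst a) f) => //; exact: Cn_cst. Qed.

Lemma CnB n f g : Cn n f -> Cn n g -> Cn n (f \- g).
Proof.
move=> Cf Cg; rewrite (_ : f \- g = f \+ (fun x => -1 * g x)).
  by apply: CnD => //; exact: CnZ.
by apply/funext => x; rewrite /= mulN1r.
Qed.

Lemma CnV n f : (forall x, f x != 0) -> Cn n f -> Cn n (fun x => (f x)^-1).
Proof.
move=> f0; elim: n => [|n IH] Hf; have [cf Cf] := Hf.
  by split=> // x; apply: cvgV => //; exact: cf.
have [df Df] := Cf.
split; first by move=> x; apply: cvgV => //; exact: cf.
split=> [x v|v]; first by apply: derivableV.
rewrite (_ : 'D_v (fun x => (f x)^-1) =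
   (fun x => -1 * (((fun x => (f x)^-1) \* (fun x => (f x)^-1)) x * 'D_v f x))); last first.
  apply/funext => x; rewrite deriveV// /GRing.scale /= mulN1r mulNr.
  by rewrite -exprVn expr2.
apply: CnZ; apply: CnM; last exact: Df.
by apply: CnM; apply/IH/CnW.
Qed.

(** The difference quotient in direction [v] is exactly [c v], so the first derivatives are constant
    functions. *)
Lemma Cn_affine_functional n (L : V -> R) (c : V -> R) :
  continuous L -> (forall x v h, L (h *: v + x) = h * c v + L x) -> Cn n L.
Proof.
move=> cL HL; case: n => [|n]; split=> //.
have key x v : h^-1 *: ((L \o shift x) (h *: v) - L x) @[h --> 0^'] --> c v.
  apply: cvg_near_cst.
  near=> h; rewrite /= HL addrK /GRing.scale /= mulKf//.
  by near: h; exact: nbhs_dnbhs_neq.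
split=> [x v|v]; first by apply/cvg_ex; exists (c v); exact: key.
rewrite (_ : 'D_v L = cst (c v)); first exact: Cn_cst.
by apply/funext => x; exact/cvg_lim.
Unshelve. all: by end_near. Qed.

Lemma aff_line (a x v : V) (c h : R) :
  a + c *: (h *: v + x) = h *: (c *: v) + (a + c *: x).
Proof. by rewrite scalerDr addrCA !scalerA mulrC. Qed.

Lemma derivable_aff f (a : V) (c : R) x v :
  derivable (fun y => f (a + c *: y)) x v = derivable f (a + c *: x) (c *: v).
Proof.
rewrite /derivable (_ : (fun h => _) = fun h =>
  h^-1 *: ((f \o shift (a + c *: x)) (h *: (c *: v)) - f (a + c *: x)))//.
by apply/funext => h /=; rewrite aff_line.
Qed.

Lemma derive_aff f (a : V) (c : R) x v :
  'D_v (fun y => f (a + c *: y)) x = 'D_(c *: v) f (a + c *: x).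
Proof.
rewrite /derive; set g1 := fun h => _; set g2 := fun h => _.
suff -> : g1 = g2 by [].
by apply/funext => h; rewrite /g1 /g2 /= aff_line.
Qed.

Lemma continuous_aff (a : V) (c : R) : continuous (fun y : V => a + c *: y).
Proof.
move=> x; apply: (@continuousD _ _ _ (cst a) ( *:%R c)).
  exact: cst_continuous.
exact: scaler_continuous.
Qed.

Lemma Cn_aff n f (a : V) (c : R) : Cn n f -> Cn n (fun y => f (a + c *: y)).
Proof.
have cc g : continuous g -> continuous (fun y => g (a + c *: y)).
  move=> cg x; apply: (@cvg_comp _ _ _ (fun y => a + c *: y) g); last exact: cg.
  exact: continuous_aff.
elim: n f => [|n IH] f [cf Cf]; split => //; try exact: cc.
case: Cf => df Df; split=> [x v|v]; first by rewrite derivable_aff.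
rewrite (_ : 'D_v _ = fun y => 'D_(c *: v) f (a + c *: y)); first exact: (IH _ (Df _)).
by apply/funext => x; rewrite derive_aff.
Qed.

(** Chain rule for [h |-> h c] on the line through [x]. It serves the reflections [y |-> x - y] and
    the dilations of the cutoff. *)
Lemma derive_dir_scale f x v (c : R) : derivable f x v ->
  derivable f x (c *: v) /\ 'D_(c *: v) f x = c * 'D_v f x.
Proof.
have E w : 'D_w f x = 'D_1 (fun h : R => f (h *: w + x)) 0.
  rewrite /derive; set g1 := fun h => _; set g2 := fun h => _.
  suff -> : g1 = g2 by [].
  by apply/funext => h; rewrite /g1 /g2 /= addr0 scale0r add0r [_%:A]mulr1.
move=> /derivable1P dfv; rewrite derivable1P !E.
set g := (fun h : R => f (h *: v + x)) in dfv *.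
have dg : is_derive (0 * c) 1 g ('D_1 g 0) by rewrite mul0r; exact: DeriveDef.
have dc : is_derive (0 : R) (1 : R) (fun h : R => h * c : R) c.
  by apply: is_derive_eq; rewrite scaler0 add0r; exact: mulr1.
have := @is_derive1_comp _ g (fun h => h * c) _ _ _ dg dc.
rewrite (_ : g \o _ = fun h : R => f (h *: (c *: v) + x)); last first.
  by apply/funext => h; rewrite /g /= scalerA.
by case=> ? ?; split => //; rewrite mulrC.
Qed.

End smooth_calculus.

(** * Continuous functions with bounded support *)

Section compact_support.
Context (R : realType).
Local Notation mu3 := (@lebesgue_measure3 R).
Implicit Types (h : R3 R -> R) (M : R).

Definition box3 M : set (R3 R) := `[- M, M] `*` `[- M, M] `*` `[- M, M].

Lemma norm3_le M (x : R3 R) :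
  (`|x| <= M) = [&& `|x.1.1| <= M, `|x.1.2| <= M & `|x.2| <= M].
Proof. by rewrite prod_normE ge_max prod_normE ge_max andbA. Qed.

Lemma box3P M (x : R3 R) : box3 M x <-> `|x| <= M.
Proof.
rewrite norm3_le /box3 /= !in_itv /= !ler_norml; split.
  by move=> [[-> ->] ->].
by move=> /and3P[-> -> ->].
Qed.

Lemma compact_box3 M : compact (box3 M).
Proof.
apply: compact_setX; last exact: segment_compact.
by apply: compact_setX; exact: segment_compact.
Qed.

Lemma measurable_box3 M : measurable (box3 M : set (M3 R)).
Proof. by apply: measurableX => //; apply: measurableX. Qed.

Lemma lebesgue_box3_lty M : (mu3 (box3 M) < +oo)%E.
Proof.
have fin : (@lebesgue_measure R (`[(- M)%R, M%R]%classic : set R) < +oo)%E.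
  by rewrite lebesgue_measure_itv /=; case: ifP => _; rewrite ?ltry// -EFinB ltry.
have fin2 : (@lebesgue_measure2 R
    ((`[(- M)%R, M]%classic : set R) `*` (`[(- M)%R, M]%classic : set R)) < +oo)%E.
  rewrite /lebesgue_measure2 product_measure1E//.
  by rewrite lte_mul_pinfty// ge0_fin_numE.
rewrite /lebesgue_measure3 product_measure1E//; last exact: measurableX.
by rewrite lte_mul_pinfty// ge0_fin_numE.
Qed.

(** Boundedness of the support passes to products and derivatives more directly than compactness of
    its closure; [test_functionP] shows that the two conditions agree. *)
Definition bsupp h := exists M, forall x : R3 R, M < `|x| -> h x = 0.

Definition cont_bsupp h := continuous h /\ bsupp h.

Lemma cont_bsupp_bounded h : cont_bsupp h -> exists B, forall x, `|h x| <= B.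
Proof.
move=> [ch [M hM]].
(* The bound [M] may be negative; with its absolute value the box is nonempty, as the extreme value
   theorem requires. *)
have [c _ hc] : exists2 c, c \in box3 `|M| &
    forall t, t \in box3 `|M| -> `|h t| <= `|h c|.
  apply: (@compact_EVT_max _ _ (fun x => `|h x|)).
  - by exists 0; apply/box3P; rewrite normr0.
  - exact: compact_box3.
  - apply: continuous_subspaceT => x.
    by apply: cvg_norm; exact: ch.
exists `|h c| => x.
have [xM|Mx] := lerP `|x| `|M|; first by apply: hc; rewrite inE; exact/box3P.
by rewrite hM ?normr0// (le_lt_trans (ler_norm _) Mx).
Qed.

Lemma cont_bsupp_measurable h : cont_bsupp h -> measurable_fun (setT : set (M3 R)) h.
Proof. by move=> [ch _]; exact: continuous_measurable3. Qed.

Lemma bounded_bsupp_integrable h : measurable_fun (setT : set (M3 R)) h ->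
  bsupp h -> (exists B, forall x, `|h x| <= B) ->
  mu3.-integrable setT (EFin \o h).
Proof.
move=> mh [M hM] [B hB].
have -> : EFin \o h = (EFin \o h) \_ (box3 M).
  apply/funext => x; rewrite /patch; case: ifPn => // /negP xM /=.
  by rewrite hM// ltNge; apply/negP => /box3P; rewrite -inE.
apply/(integrable_mkcond _ (measurable_box3 M)).
apply: measurable_bounded_integrable.
- exact: measurable_box3.
- exact: lebesgue_box3_lty.
- exact: measurable_funTS.
- exists B; split; first exact: num_real.
  by move=> N BN x _; exact: le_trans (hB x) (ltW BN).
Qed.

Lemma cont_bsupp_integrable h : cont_bsupp h -> mu3.-integrable setT (EFin \o h).
Proof.
move=> cch; apply: bounded_bsupp_integrable; first exact: cont_bsupp_measurable.
  by case: cch.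
exact: cont_bsupp_bounded.
Qed.

Lemma bsuppM h (g : R3 R -> R) : bsupp h -> bsupp (fun x => h x * g x).
Proof. by move=> [M hM]; exists M => x /hM ->; rewrite mul0r. Qed.

Lemma cont_bsuppM h (g : R3 R -> R) : cont_bsupp h -> continuous g ->
  cont_bsupp (fun x => h x * g x).
Proof.
move=> [ch sh] cg; split; last exact: bsuppM.
by move=> x; apply: cvgM; [exact: ch|exact: cg].
Qed.

Lemma test_functionP h : test_function h <-> smooth h /\ bsupp h.
Proof.
split=> [[sh]|[sh [M hM]]].
  move=> /compact_bounded[M [_ HM]]; split => //; exists (M + 1) => x Mx.
  apply/eqP/negPn/negP => hx.
  have : `|x| <= M + 1.
    by apply: HM; [rewrite ltrDl|apply: subset_closure].
  by rewrite leNgt Mx.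
split=> //; apply: (@subclosed_compact _ _ (box3 M)).
- exact: closed_closure.
- exact: compact_box3.
- rewrite /fun_supp closureE; apply: smallest_sub => //.
    apply: compact_closed; last exact: compact_box3.
    exact: norm_hausdorff.
  move=> x /= hx; apply/box3P; rewrite leNgt; apply/negP => /hM hx0.
  by rewrite hx0 eqxx in hx.
Qed.

Lemma bsupp_derive h v : bsupp h -> bsupp ('D_v h).
Proof.
move=> [M hM]; exists M => x Mx.
rewrite (@near_eq_derive _ _ _ h (cst 0)) ?derive_cst//.
near=> y; apply: hM; near: y.
by apply: (@cvgr_gt _ _ _ _ (fun y : R3 R => `|y|) `|x|) => //; exact: norm_continuous.
Unshelve. all: by end_near. Qed.

(** Reduces a limit over a normed space to sequences, the setting of dominated convergence. *)
Lemma cvg_seqP (V : normedModType R) (F : V -> R) (x : V) :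
  (forall u : nat -> V, u n @[n --> \oo] --> x -> F (u n) @[n --> \oo] --> F x) ->
  F y @[y --> x] --> F x.
Proof.
move=> H; apply/cvgrPdist_lt => e e0; apply: contrapT => N.
have : forall n : nat, exists y, `|x - y| < n.+1%:R^-1 /\ e <= `|F x - F y|.
  move=> n; apply: contrapT => /forallNP h; apply: N.
  apply/nbhs_ballP; exists (n.+1%:R^-1) => /=; first by rewrite invr_gt0.
  move=> y; rewrite -ball_normE /= => xy.
  by rewrite ltNge; apply/negP => ey; apply: (h y).
move=> /choice[u hu].
have ux : u n @[n --> \oo] --> x.
  apply/cvgrPdist_lt => d d0.
  have /cvgrPdist_lt/(_ _ d0) := @cvg_harmonic R.
  apply: filterS => n; rewrite /= sub0r normrN ger0_norm ?invr_ge0// => hd.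
  by rewrite (lt_trans _ hd)//; case: (hu n).
have /cvgrPdist_lt/(_ _ e0)[n _ /(_ n (leqnn n))] := H u ux.
by rewrite /= ltNge; case: (hu n) => _ ->.
Qed.

Lemma continuous_integral (V : normedModType R) (f : V -> R3 R -> R) (g : R3 R -> R)
    (x : V) (r : R) :
  0 < r ->
  (forall y, measurable_fun (setT : set (M3 R)) (f y)) ->
  mu3.-integrable setT (EFin \o g) ->
  (forall y z, `|x - y| < r -> `|f y z| <= g z) ->
  (forall z, f y z @[y --> x] --> f x z) ->
  (\int[mu3]_z f y z) @[y --> x] --> \int[mu3]_z f x z.
Proof.
move=> r0 mf ig fg cf; apply: cvg_seqP => u ux.
(* The domination by [g] is assumed only within distance [r] of [x], so the sequence is replaced by
   a tail. *)
have [N _ hN] : \forall n \near \oo, `|x - u n| < r.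
  by move/cvgrPdist_lt : ux; apply.
rewrite -(cvg_shiftn N).
have fx z : `|f x z| <= g z by apply: fg; rewrite subrr normr0.
have fu n z : `|f (u (n + N)%N) z| <= g z by apply: fg; apply: hN; exact: leq_addl.
apply: fine_cvg; rewrite fineK; last first.
  rewrite fin_num_abs; apply: (le_lt_trans (le_abse_integral _ _ _)) => //.
    exact/measurable_EFinP.
  have /integrableP[_] := ig; apply: le_lt_trans.
  apply: ge0_le_integral => //.
  - exact/measurable_EFinP/measurableT_comp.
  - by apply: measurableT_comp => //; case/integrableP : ig.
  - by move=> z _ /=; rewrite lee_fin (le_trans (fx z))// ler_norm.
apply: (@dominated_cvg _ _ _ mu3 setT measurableT
    (fun n z => (f (u (n + N)%N) z)%:E) (fun z => (f x z)%:E) (EFin \o g)) => //=.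
- by move=> n; exact/measurable_EFinP.
- move=> z _; apply: cvg_EFin; first exact: nearW.
  have ux' : u (n + N)%N @[n --> \oo] --> x by rewrite cvg_shiftn.
  exact: (cvg_comp _ (f ^~ z) ux' (cf z)).
- by move=> n z _; rewrite lee_fin.
Qed.

End compact_support.

(** * Oscillatory integrals *)

Section oscillatory.
Context (R : realType).
Local Notation mu3 := (@lebesgue_measure3 R).
Implicit Types (h : R3 R -> R) (a : R) (x v xi : R3 R).

Lemma dot3E x v : dot3 x v = x.1.1 * v.1.1 + x.1.2 * v.1.2 + x.2 * v.2.
Proof. by rewrite /dot3 !big_ord_recr big_ord0 /= add0r. Qed.

Lemma dot3C x v : dot3 x v = dot3 v x.
Proof. by rewrite !dot3E; ring. Qed.

Lemma dot3_line x v xi (t : R) : dot3 (t *: v + x) xi = t * dot3 v xi + dot3 x xi.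
Proof. by rewrite !dot3E /= /GRing.scale /=; ring. Qed.

Lemma continuous_dot3 v : continuous (dot3 v).
Proof.
rewrite (_ : dot3 v = fun x => v.1.1 * x.1.1 + v.1.2 * x.1.2 + v.2 * x.2); last first.
  by apply/funext => x; rewrite dot3E.
move=> x; have c1 := @cvg_fst _ _ _ _ (nbhs_filter x.2) : fst @ x --> x.1.
apply: cvgD; first apply: cvgD; (apply: cvgM; first exact: cvg_cst).
- by apply: (@cvg_comp _ _ _ fst fst _ _ _ c1); exact: cvg_fst.
- by apply: (@cvg_comp _ _ _ fst snd _ _ _ c1); exact: cvg_snd.
- exact: cvg_snd.
Qed.

Lemma continuous_dot3l v : continuous (fun x => dot3 x v).
Proof.
rewrite (_ : (fun x => _) = dot3 v); first exact: continuous_dot3.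
by apply/funext => x; rewrite dot3C.
Qed.

Lemma Cn_dot3 n v : Cn n (dot3 v).
Proof.
apply: (@Cn_affine_functional _ _ n (dot3 v) (dot3 v)).
  exact: continuous_dot3.
by move=> x w t; rewrite ![dot3 v _]dot3C dot3_line.
Qed.

Lemma continuous_phase x a : continuous (fun xi => cos (dot3 x xi - a)).
Proof.
move=> xi; apply: (@cvg_comp _ _ _ (fun xi => dot3 x xi - a) cos).
  by apply: cvgB; [exact: continuous_dot3|exact: cvg_cst].
exact: continuous_cos.
Qed.

Lemma continuous_phasel xi a : continuous (fun x => cos (dot3 x xi - a)).
Proof.
move=> x; apply: (@cvg_comp _ _ _ (fun x => dot3 x xi - a) cos).
  by apply: cvgB; [exact: continuous_dot3l|exact: cvg_cst].
exact: continuous_cos.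
Qed.

Lemma cos_quarter a (t : R) : cos (t - (a - pi / 2)) = - sin (t - a).
Proof.
rewrite (_ : t - (a - pi / 2) = (t - a) + pi / 2); last by ring.
by rewrite cosDpihalf.
Qed.

(* The phase [a = 0] gives the real part, and [a = pi / 2] the imaginary part,
   of the unnormalised inverse Fourier transform of a real [h].  Both
   differentiation in [x] and multiplication by [x] shift [a] by [- pi / 2]. *)
Definition oscint h a x : R := \int[mu3]_xi (h xi * cos (dot3 x xi - a)).

Lemma cont_bsupp_phase h a x : cont_bsupp h ->
  cont_bsupp (fun xi => h xi * cos (dot3 x xi - a)).
Proof. by move=> cch; apply: cont_bsuppM => //; exact: continuous_phase. Qed.

Lemma oscint_bound h a x : cont_bsupp h -> `|oscint h a x| <= \int[mu3]_xi `|h xi|.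
Proof.
move=> cch; have ih := cont_bsupp_integrable (cont_bsupp_phase a x cch).
apply: (le_trans (le_normr_Rintegral _ ih)) => //.
apply: le_Rintegral => //.
- exact: (integrable_norm ih).
- exact: (integrable_norm (cont_bsupp_integrable cch)).
by move=> xi _; rewrite normrM ler_piMr// ler_norml cos_geN1 cos_le1.
Qed.

Lemma continuous_oscint h a : cont_bsupp h -> continuous (oscint h a).
Proof.
move=> cch x.
apply: (@continuous_integral _ _ (fun x xi => h xi * cos (dot3 x xi - a))
  (fun xi => `|h xi|) x 1) => //.
- by move=> y; apply: cont_bsupp_measurable; exact: cont_bsupp_phase.
- exact: (integrable_norm (cont_bsupp_integrable cch)).
- by move=> y z _; rewrite normrM ler_piMr// ler_norml cos_geN1 cos_le1.
- by move=> z; apply: cvgM; [exact: cvg_cst|exact: continuous_phasel].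
Qed.

(** Differentiation under the integral along the line [t v + x]: since the cosine is at most 1 in
    modulus, [|h xi * dot3 v xi|] dominates the derivative for all [t] at once. *)
Lemma oscint_derive h a x v : cont_bsupp h ->
  derivable (oscint h a) x v /\
  'D_v (oscint h a) x = oscint (fun xi => h xi * dot3 v xi) (a - pi / 2) x.
Proof.
move=> cch.
pose f (t : R) xi := h xi * cos (dot3 (t *: v + x) xi - a).
pose df (t : R) xi := h xi * dot3 v xi * cos (dot3 (t *: v + x) xi - (a - pi / 2)).
have fd t xi : is_derive t (1 : R) (f ^~ xi) (df t xi).
  have D1 : is_derive t (1 : R) (fun t : R => dot3 (t *: v + x) xi - a) (dot3 v xi).
    rewrite (_ : (fun _ => _) = (fun t : R => t * dot3 v xi + (dot3 x xi - a))).
      apply: is_derive_eq. rewrite /GRing.scale /=; ring.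
    by apply/funext => s; rewrite dot3_line addrA.
  have := @is_derive1_comp _ cos _ t _ _ (is_derive_cos _) D1.
  move=> D2; rewrite /f.
  have := @is_deriveM _ _ (cst (h xi)) _ t 1 _ _ (is_derive_cst _ _ _) D2.
  move=> D3; apply: (is_derive_eq D3).
  by rewrite /df cos_quarter /= scaler0 addr0 /GRing.scale /=; ring.
have key := @cvg_differentiation_under_integral R _ _ mu3 f setT measurableT
  0 (-1) 1 _ _ _
  (fun xi => `|h xi * dot3 v xi|) _ _ _.
have -> : oscint (fun xi => h xi * dot3 v xi) (a - pi / 2) x =
    \int[mu3]_y partial1of2 f 0 y.
  apply: eq_Rintegral => xi _; rewrite /= partial1of2E.
  have [_ ->] := fd 0 xi.
  by rewrite /df scale0r add0r.
have cch' : cont_bsupp (fun xi => h xi * dot3 v xi).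
  by apply: cont_bsuppM => //; exact: continuous_dot3.
have lim1 : t^-1 *: ((oscint h a \o shift x) (t *: v) - oscint h a x)
      @[t --> (0 : R)^'] -->
    \int[mu3]_y partial1of2 f 0 y.
  rewrite (_ : (fun t => _) = (fun t : R =>
    t^-1 *: (\int[mu3]_y f (t + 0) y - \int[mu3]_y f 0 y))); last first.
    by apply/funext => t; rewrite /f scale0r add0r addr0.
  apply: key.
  - by rewrite /= in_itv /= ltrN10 ltr01.
  - by move=> t _; apply: cont_bsupp_integrable; exact: cont_bsupp_phase.
  - by move=> t xi _ _; case: (fd t xi).
  - by [].
  - exact: (integrable_norm (cont_bsupp_integrable cch')).
  - move=> t xi _ _; rewrite partial1of2E; have [_ ->] := fd t xi.
    by rewrite /df normrM ler_piMr// ler_norml cos_geN1 cos_le1.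
split; first by apply/cvg_ex; exists (\int[mu3]_y partial1of2 f 0 y).
exact/cvg_lim.
Qed.

Lemma Cn_oscint n h a : cont_bsupp h -> Cn n (oscint h a).
Proof.
elim: n h a => [|n IH] h a cch; split => //; try exact: continuous_oscint.
split=> [x v|v]; first by case: (oscint_derive a x v cch).
rewrite (_ : 'D_v _ = oscint (fun xi => h xi * dot3 v xi) (a - pi / 2)).
  by apply: IH; apply: cont_bsuppM => //; exact: continuous_dot3.
by apply/funext => x; case: (oscint_derive a x v cch).
Qed.

End oscillatory.

(** * Integration by parts, decay and scaling of oscillatory integrals *)

Section by_parts.
Context (R : realType).
Local Notation mu3 := (@lebesgue_measure3 R).
Implicit Types (h F : R3 R -> R) (a : R) (x v xi : R3 R).

Lemma is_derive_line (V : normedModType R) (G : V -> R) (x v : V) (t : R) :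
  derivable G (t *: v + x) v ->
  is_derive t (1 : R) (fun s : R => G (s *: v + x)) ('D_v G (t *: v + x)).
Proof.
move=> dG.
have E : (fun s : R => s^-1 *: (((fun s : R => G (s *: v + x)) \o shift t)
      (s *: (1 : R)) - G (t *: v + x)))
   = (fun s => s^-1 *: ((G \o shift (t *: v + x)) (s *: v) - G (t *: v + x))).
  apply/funext => s /=; congr (_ *: (G _ - _)).
  by rewrite [_%:A]mulr1 scalerDl addrA.
by apply: DeriveDef; [rewrite /derivable E|rewrite /derive E].
Qed.

Lemma is_derive_of_line (V : normedModType R) (G : V -> R) (x v : V) (d : R) :
  is_derive (0 : R) (1 : R) (fun s : R => G (s *: v + x)) d -> is_derive x v G d.
Proof.
have E : (fun s : R => s^-1 *: (((fun s : R => G (s *: v + x)) \o shift 0)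
      (s *: (1 : R)) - G (0 *: v + x)))
   = (fun s => s^-1 *: ((G \o shift x) (s *: v) - G x)).
  by apply/funext => s /=; rewrite [_%:A]mulr1 addr0 scale0r add0r.
by move=> [dG <-]; apply: DeriveDef; [rewrite /derivable -E|rewrite /derive -E].
Qed.

Lemma dilates_shift x : dilates mu3 1 (fun y => y + x).
Proof.
have := @dilates_lebesgue3 R x 1 (oner_neq0 R).
rewrite normr1 invr1 expr1n (_ : aff x 1 = fun y => y + x)//.
by apply/funext => y; rewrite /aff scale1r addrC.
Qed.

(* [\int F (t v + x) dx] does not depend on [t] by translation invariance;
   differentiate it under the integral at [t = 0]. *)
Lemma integral_derive0 F v : cont_bsupp F -> (forall x, derivable F x v) ->
  continuous ('D_v F) -> \int[mu3]_x 'D_v F x = 0.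
Proof.
move=> ccF dF cDF.
have ccDF : cont_bsupp ('D_v F) by split=> //; apply: bsupp_derive; case: ccF.
pose f (t : R) xi := F (t *: v + xi).
have fint t : \int[mu3]_xi f t xi = \int[mu3]_xi F xi.
  rewrite /f; under eq_Rintegral do rewrite addrC.
  rewrite (dilates_Rintegral ltr01 (dilates_shift (t *: v))) ?mul1r//.
  exact: cont_bsupp_measurable.
have [B hB] := cont_bsupp_bounded ccDF.
have [_ [M hM]] := ccDF.
(* ['D_v F] vanishes beyond radius [M], and a shift by [t v] with [|t| < 1] moves a point by at most
   [|v|]. *)
pose G : R3 R -> R := fun xi => `|B| * \1_(box3 (`|M| + `|v|)) xi.
have key := @cvg_differentiation_under_integral R _ _ mu3 f setT measurableT
  0 (-1) 1 _ _ _
  G _ _ _.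
have d1 t xi : partial1of2 f t xi = 'D_v F (t *: v + xi).
  by rewrite partial1of2E; have [_ ->] := is_derive_line (dF (t *: v + xi)).
have : (fun t : R => t^-1 *: (\int[mu3]_y f (t + 0) y - \int[mu3]_y f 0 y)) t
      @[t --> (0 : R)^'] -->
    \int[mu3]_y partial1of2 f 0 y.
  apply: key.
  - by rewrite /= in_itv /= ltrN10 ltr01.
  - move=> t _.
    rewrite (_ : f t = F \o (fun y => y + t *: v)); last first.
      by apply/funext => y; rewrite /f /= addrC.
    apply: (dilates_integrable ltr01 (dilates_shift (t *: v))).
    exact: cont_bsupp_integrable.
  - by move=> t xi _ _; case: (is_derive_line (dF (t *: v + xi))).
  - by move=> xi; rewrite /G mulr_ge0.
  - apply: bounded_bsupp_integrable.
    + apply: measurable_funM => //.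
      by apply: measurable_indic; exact: measurable_box3.
    + exists (`|M| + `|v|) => x Mx; rewrite /G indicE memNset ?mulr0//.
      by move=> /box3P; rewrite leNgt Mx.
    + exists `|B| => x; rewrite /G indicE.
      by case: (_ \in _); rewrite ?mulr1 ?mulr0 ?normr0 ?normr_id.
  - move=> t xi; rewrite /= in_itv /= => /andP[t1 t2] _; rewrite d1 /G indicE.
    have [xM|xM] := boolP (xi \in _); first by rewrite mulr1 (le_trans (hB _))// ler_norm.
    rewrite mulr0 hM ?normr0//.
    have {}xM : `|M| + `|v| < `|xi|.
      by rewrite ltNge; apply/negP => /box3P h; move/negP: xM; apply; rewrite inE.
    have tv : `|t *: v| <= `|v|.
      by rewrite normrZ ler_piMl// ler_norml !ltW.
    have := lerB_normD xi (t *: v); rewrite [xi + _]addrC.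
    have := ler_norm M; lra.
(* By [fint] every difference quotient of the integral is zero. *)
under eq_fun do rewrite !fint subrr scaler0.
move=> /cvg_lim E.
transitivity (\int[mu3]_y partial1of2 f 0 y).
  by apply: eq_Rintegral => y _; rewrite d1 scale0r add0r.
by rewrite -E ?lim_cst.
Qed.

(** The function [c(xi) = cos (x . xi - a - pi / 2)] satisfies [D_v c = (x . v) cos (x . xi - a)];
    the claim is that the integral of [D_v (h c)] is zero. *)
Lemma oscint_by_parts h a x v : cont_bsupp h -> (forall x, derivable h x v) ->
  continuous ('D_v h) ->
  dot3 x v * oscint h a x = oscint ('D_v h) (a - pi / 2) x.
Proof.
move=> cch dh cDh.
have ccDh : cont_bsupp ('D_v h) by split=> //; apply: bsupp_derive; case: cch.
pose F xi := h xi * cos (dot3 x xi - (a + pi / 2)).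
pose c (xi : R3 R) := cos (dot3 x xi - (a + pi / 2)).
have dc xi : is_derive xi v c (dot3 x v * cos (dot3 x xi - a)).
  apply: is_derive_of_line.
  have D1 : is_derive (0 : R) (1 : R)
      (fun t : R => dot3 x (t *: v + xi) - (a + pi / 2)) (dot3 x v).
    rewrite (_ : (fun _ => _) = (fun t : R => t * dot3 x v + (dot3 x xi - (a + pi / 2)))).
      by apply: is_derive_eq; rewrite scaler0 add0r addr0; exact: mulr1.
    by apply/funext => s; rewrite ![dot3 x _]dot3C dot3_line addrA.
  have D2 := @is_derive1_comp _ cos _ 0 _ _ (is_derive_cos _) D1.
  apply: (is_derive_eq D2); rewrite scale0r add0r mulrC; congr (_ * _).
  by rewrite -cos_quarter; congr cos; field.
have DF : 'D_v F = fun xi => 'D_v h xi * c xi + dot3 x v * (h xi * cos (dot3 x xi - a)).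
  apply/funext => xi.
  have [_ ->] := is_deriveM (derivableP (dh xi)) (dc xi).
  by rewrite /GRing.scale /=; ring.
have dF xi : derivable F xi v.
  by have [] := is_deriveM (derivableP (dh xi)) (dc xi).
have ccF : cont_bsupp F by exact: cont_bsupp_phase.
have cc1 : cont_bsupp (fun xi => 'D_v h xi * c xi) by exact: cont_bsupp_phase.
have cc2 : cont_bsupp (fun xi => h xi * cos (dot3 x xi - a)) by exact: cont_bsupp_phase.
have cc3 : cont_bsupp (fun xi => dot3 x v * (h xi * cos (dot3 x xi - a))).
  rewrite (_ : (fun xi => _) =
    (fun xi => (h xi * cos (dot3 x xi - a)) * cst (dot3 x v) xi)).
    by apply: cont_bsuppM => //; exact: cst_continuous.
  by apply/funext => xi; rewrite mulrC.
have cDF : continuous ('D_v F).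
  by rewrite DF => xi; apply: cvgD; [case: cc1 => + _; apply|case: cc3 => + _; apply].
have := integral_derive0 ccF dF cDF.
rewrite DF RintegralD//;
  [|exact: (cont_bsupp_integrable cc1)|exact: (cont_bsupp_integrable cc3)].
rewrite RintegralZl//; last exact: (cont_bsupp_integrable cc2).
move=> /eqP; rewrite addrC addr_eq0 => /eqP ->.
rewrite -mulN1r -RintegralZl//; last exact: (cont_bsupp_integrable cc1).
apply: eq_Rintegral => xi _; rewrite cos_quarter mulN1r -mulrN; congr (_ * - _).
by rewrite /c (_ : _ - _ = dot3 x xi - a - pi / 2) ?cosBpihalf//; ring.
Qed.

(** A product weight: each factor costs one integration by parts, and by Tonelli its inverse is in
    [L^2] because [(1 + |s|)^-2] is integrable on the line. *)
Definition weight3 x : R := (1 + `|x.1.1|) * (1 + `|x.1.2|) * (1 + `|x.2|).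

Lemma weight3_ge1 x : 1 <= weight3 x.
Proof. by rewrite /weight3; do 2 ?[apply: mulr_ege1]; rewrite lerDl. Qed.

Lemma cont_bsupp_Cn0 h : Cn 0 h -> bsupp h -> cont_bsupp h.
Proof. by case. Qed.

(** In each factor [1 + |x . v|], the 1 keeps [h] and the second term trades [h] for ['D_v h]. The
    bound is uniform in [a] since integrating by parts shifts the phase. *)
Lemma oscint_decay_seq (s : seq (R3 R)) h : Cn (size s) h -> bsupp h ->
  exists C, forall a x, (\prod_(v <- s) (1 + `|dot3 x v|)) * `|oscint h a x| <= C.
Proof.
elim: s h => [|v s IH] h Ch sh.
  exists (\int[mu3]_xi `|h xi|) => a x; rewrite big_nil mul1r.
  exact/oscint_bound/cont_bsupp_Cn0.
have cch : cont_bsupp h by split=> //; exact: Cn_continuous Ch.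
have [_ [dh /(_ v) CDh]] := Ch.
have [C hC] := IH h (CnW Ch) sh.
have [C' hC'] := IH ('D_v h) CDh (bsupp_derive v sh).
exists (C + C') => a x; rewrite big_cons -mulrA mulrDl mul1r.
rewrite mulrCA -normrM (oscint_by_parts a x cch (fun x => dh x v) (Cn_continuous CDh)).
by rewrite lerD.
Qed.

Lemma oscint_decay h : Cn 3 h -> bsupp h ->
  exists2 C, 0 <= C & forall a x, `|oscint h a x| <= C / weight3 x.
Proof.
move=> Ch sh.
have [C hC] := @oscint_decay_seq [:: ((1, 0), 0); ((0, 1), 0); ((0, 0), 1)] h Ch sh.
have w0 x : 0 < weight3 x by rewrite (lt_le_trans ltr01)// weight3_ge1.
have H a x : `|oscint h a x| <= C / weight3 x.
  rewrite ler_pdivlMr// mulrC; apply: le_trans (hC a x).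
  rewrite !big_cons big_nil !dot3E /= !mulr0 !mulr1 !addr0 !add0r.
  by rewrite /weight3 !mulrA.
exists C => //.
by have := le_trans (normr_ge0 _) (H 0 0); rewrite ler_pdivlMr// mul0r.
Qed.

Lemma oscint_scale h (c : R) a x : cont_bsupp h -> 0 < c ->
  oscint (fun xi => h (c^-1 *: xi)) a x = c ^+ 3 * oscint h a (c *: x).
Proof.
move=> cch c0.
have c0' : c^-1 != 0 by rewrite invr_eq0 gt_eqF.
rewrite /oscint -(@dilates_Rintegral R _ _ mu3 (c ^+ 3) (aff 0 c^-1)
   (fun xi => h xi * cos (dot3 (c *: x) xi - a))).
- apply: eq_Rintegral => xi _; rewrite /aff add0r; congr (_ * cos (_ - _)).
  by rewrite !dot3E /= /GRing.scale /=; field; rewrite gt_eqF.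
- by rewrite exprn_gt0.
- have := dilates_lebesgue3 0 c0'.
  by rewrite gtr0_norm ?invr_gt0// invrK.
- by apply: cont_bsupp_measurable; exact: cont_bsupp_phase.
Qed.

End by_parts.

(** * Square-integrable functions *)

Section square_integrable.
Context d (T : measurableType d) (R : realType).
Variable mu : {measure set T -> \bar R}.
Implicit Types f g : T -> R.

Definition sqnorm f : R := \int[mu]_x (f x ^+ 2).

Lemma integrable_cmul f (c : R) : mu.-integrable setT (EFin \o f) ->
  mu.-integrable setT (EFin \o (fun x => c * f x)).
Proof. by move=> fi; exact: (integrableZl measurableT c fi). Qed.

Lemma integrable_sub f g : mu.-integrable setT (EFin \o f) ->
  mu.-integrable setT (EFin \o g) ->
  mu.-integrable setT (EFin \o (fun x => f x - g x)).
Proof. by move=> fi gi; exact: (integrableB measurableT fi gi). Qed.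

Lemma Lfun2_measurable f : f \in Lfun mu 2%:E -> measurable_fun setT f.
Proof. by rewrite inE => /andP[/[!inE]/=]. Qed.

Lemma Lfun2P f : f \in Lfun mu 2%:E <->
  measurable_fun setT f /\ mu.-integrable setT (EFin \o (fun x => f x ^+ 2)).
Proof.
split=> [Lf|[mf /integrableP[_ fi]]].
  by split; [exact: Lfun2_measurable|exact: Lfun2_integrable_sqr].
rewrite inE; apply/andP; split; rewrite inE//=.
rewrite /finite_norm unlock /=; apply: poweR_lty; apply: le_lt_trans fi.
apply: ge0_le_integral => //.
- apply/measurable_EFinP.
  apply: (@measurableT_comp _ _ _ _ _ _ (fun x : R => x `^ 2)) => //.
  exact: measurableT_comp.
- by apply: measurableT_comp => //; apply/measurable_EFinP/measurable_funX.
- by move=> x _; rewrite lee_fin /= normrX powR_mulrn.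
Qed.

Lemma Lfun2_le f g : measurable_fun setT f -> g \in Lfun mu 2%:E ->
  (forall x, `|f x| <= `|g x|) -> f \in Lfun mu 2%:E.
Proof.
move=> mf /Lfun2P[mg ig] fg; apply/Lfun2P; split => //.
apply: le_integrable ig => //; first exact/measurable_EFinP/measurable_funX.
move=> x _ /=; rewrite lee_fin !normrX.
by rewrite ler_pXn2r// ?nnegrE.
Qed.

Lemma Lfun2_scale f (c : R) : f \in Lfun mu 2%:E -> (fun x => c * f x) \in Lfun mu 2%:E.
Proof.
move=> /Lfun2P[mf fi]; apply/Lfun2P; split; first exact: measurable_funM.
have := integrable_cmul (c ^+ 2) fi; apply: eq_integrable => // x _ /=.
by rewrite exprMn.
Qed.

Lemma Lfun2_mul_integrable f g : f \in Lfun mu 2%:E -> g \in Lfun mu 2%:E ->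
  mu.-integrable setT (EFin \o (fun x => f x * g x)).
Proof. by move=> Lf Lg; apply/Lfun1_integrable; exact: Lfun2_mul_Lfun1. Qed.

Lemma sqnorm_ge0 f : 0 <= sqnorm f.
Proof. by apply: Rintegral_ge0 => x _; exact: sqr_ge0. Qed.

Lemma cauchy_schwarz f g : f \in Lfun mu 2%:E -> g \in Lfun mu 2%:E ->
  (\int[mu]_x (f x * g x)) ^+ 2 <= sqnorm f * sqnorm g.
Proof.
move=> Lf Lg.
have [[mf fi] [mg gi]] := (iffLR (Lfun2P f) Lf, iffLR (Lfun2P g) Lg).
have fgi := Lfun2_mul_integrable Lf Lg.
set A := sqnorm f; set B := \int[mu]_x _; set C := sqnorm g.
have H (s t : R) : 0 <= s ^+ 2 * A - (2 * s * t) * B + t ^+ 2 * C.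
  have i1 := integrable_cmul (s ^+ 2) fi.
  have i2 := integrable_cmul (2 * s * t) fgi.
  have i3 := integrable_cmul (t ^+ 2) gi.
  have i12 := integrable_sub i1 i2.
  rewrite -!RintegralZl// -RintegralB// -RintegralD//.
  apply: Rintegral_ge0 => x _.
  by rewrite (_ : _ + _ = (s * f x - t * g x) ^+ 2) ?sqr_ge0//; ring.
have A0 : 0 <= A := sqnorm_ge0 f.
have C0 : 0 <= C := sqnorm_ge0 g.
have [A00|A1] := eqVneq A 0.
  (* For [A = 0] the form at [(C + 1, B)] equals [- (C + 2) B ^ 2], which forces [B = 0]. *)
  have := H (C + 1) B; rewrite A00 mul0r => h.
  have := mulr_ge0 C0 (sqr_ge0 B); have := sqr_ge0 B; lra.
have A2 : 0 < A by rewrite lt_neqAle eq_sym A1.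
(* This is the form at [s = B], [t = A], its minimising direction. *)
have : 0 <= A * (A * C - B ^+ 2).
  by rewrite (_ : _ * _ = B ^+ 2 * A - (2 * B * A) * B + A ^+ 2 * C) ?H//; ring.
by rewrite pmulr_rge0// subr_ge0.
Qed.

End square_integrable.

Section product_functions.
Context d1 d2 (T1 : measurableType d1) (T2 : measurableType d2) (R : realType).
Variables (m1 : {sigma_finite_measure set T1 -> \bar R})
          (m2 : {sigma_finite_measure set T2 -> \bar R}).

Lemma integrable_prod_mul (f : T1 -> R) (g : T2 -> R) :
  (forall x, 0 <= f x) -> (forall x, 0 <= g x) ->
  m1.-integrable setT (EFin \o f) -> m2.-integrable setT (EFin \o g) ->
  (m1 \x m2)%E.-integrable setT (EFin \o (fun x => f x.1 * g x.2)).
Proof.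
move=> f0 g0 /integrableP[mf fi] /integrableP[mg gi].
have mfg : measurable_fun setT (EFin \o (fun x => f x.1 * g x.2)).
  apply/measurable_EFinP; apply: measurable_funM.
    by apply: (@measurableT_comp _ _ _ _ _ _ f) => //; exact/measurable_EFinP.
  by apply: (@measurableT_comp _ _ _ _ _ _ g) => //; exact/measurable_EFinP.
apply/integrableP; split => //.
rewrite (eq_integral (EFin \o (fun x => f x.1 * g x.2))); last first.
  by move=> x _ /=; rewrite ger0_norm// mulr_ge0.
rewrite fubini_tonelli1//; last by move=> x /=; rewrite lee_fin mulr_ge0.
rewrite /fubini_F /=.
rewrite (eq_integral
  (fun x => (\int[m2]_y `|(EFin \o g) y|) * (EFin \o f) x)%E); last first.
  move=> x _ /=; rewrite muleC -ge0_integralZl//=.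
  - by apply: eq_integral => y _; rewrite EFinM ger0_norm.
  - by apply/measurable_EFinP; apply: measurableT_comp => //; exact/measurable_EFinP.
  - by rewrite lee_fin.
rewrite ge0_integralZl//.
- rewrite lte_mul_pinfty//.
  + exact: integral_ge0.
  + by rewrite ge0_fin_numE// integral_ge0.
  + move: fi; rewrite (eq_integral (EFin \o f))// => x _ /=; first by rewrite ger0_norm.
- by move=> x _; rewrite lee_fin.
- exact: integral_ge0.
Qed.

End product_functions.

(** * Square integrability of the inverse weight *)

Section weight.
Context (R : realType).
Local Notation mu3 := (@lebesgue_measure3 R).

(** Comparison with [1 / (1 + x ^ 2)], whose half-line integral is known and which is even. *)
Lemma integrable_weight1 :
  (@lebesgue_measure R).-integrable setT (EFin \o (fun x : R => (1 + `|x|) ^- 2)).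
Proof.
have mw : measurable_fun (setT : set (measurableTypeR R)) (fun x : R => (1 + `|x|) ^- 2).
  apply: continuous_measurable_fun => x.
  apply: cvgV; last first.
    apply: (@cvg_comp _ _ _ (fun x : R => 1 + `|x|) (fun y : R => y ^+ 2));
      last exact: exprn_continuous.
    apply: cvgD; first exact: cvg_cst.
    by apply: cvg_norm; exact: cvg_id.
  by rewrite expf_neq0// gt_eqF// ltr_pwDl.
have mo : measurable_fun (setT : set (measurableTypeR R)) (fun x : R => (oneDsqr x)^-1).
  by apply: continuous_measurable_fun; exact: continuous_oneDsqrV.
apply: (@le_integrable _ _ _ (@lebesgue_measure R) setT measurableT _
  (fun x : R => (oneDsqr x)^-1%:E)).
- exact/measurable_EFinP.
- move=> x _ /=.
  have p1 : 0 <= (1 + `|x|) ^- 2 by rewrite invr_ge0 exprn_ge0// addr_ge0.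
  have p2 : 0 <= (oneDsqr x)^-1 by rewrite invr_ge0.
  rewrite lee_fin (ger0_norm p1) (ger0_norm p2).
  rewrite lef_pV2 ?posrE ?exprn_gt0 ?ltr_pwDl ?sqr_ge0//.
  rewrite /oneDsqr -[x ^+ 2]real_normK ?num_real// sqrrD expr1n mul1r lerD2r.
  by rewrite lerDl mulrn_wge0.
- apply/integrableP; split; first exact/measurable_EFinP.
  have E (x : R) : `|((oneDsqr x)^-1)%:E|%E = ((oneDsqr x)^-1)%:E.
    by rewrite /= ger0_norm ?invr_ge0.
  under eq_integral do rewrite E.
  rewrite (@ge0_symfun_integralT R (fun x => (oneDsqr x)^-1)).
  - by rewrite -set_itvcy integral0y_oneDsqr -EFinM ltry.
  - by move=> x; rewrite invr_ge0.
  - exact: continuous_oneDsqrV.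
  - by move=> x; rewrite /oneDsqr /= sqrrN.
Qed.

Lemma Lfun2_weight3 : L2fun (fun x : R3 R => (weight3 x)^-1).
Proof.
have w0 (x : R) : 0 <= (1 + `|x|) ^- 2 by rewrite invr_ge0 exprn_ge0// addr_ge0.
have mw : measurable_fun (setT : set (M3 R)) (fun x : R3 R => (weight3 x)^-1).
  apply: continuous_measurable3 => x; apply: cvgV.
    by rewrite gt_eqF// (lt_le_trans ltr01)// weight3_ge1.
  have c1 := @cvg_fst _ _ _ _ (nbhs_filter x.2) : fst @ x --> x.1.
  apply: cvgM; first apply: cvgM; (apply: cvgD; first exact: cvg_cst); apply: cvg_norm.
  - by apply: (@cvg_comp _ _ _ fst fst _ _ _ c1); exact: cvg_fst.
  - by apply: (@cvg_comp _ _ _ fst snd _ _ _ c1); exact: cvg_snd.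
  - exact: cvg_snd.
apply/Lfun2P; split => //.
have i2 : (@lebesgue_measure2 R).-integrable setT
   (EFin \o (fun x : measurableTypeR R * measurableTypeR R =>
      (1 + `|x.1 : R|) ^- 2 * (1 + `|x.2 : R|) ^- 2)).
  exact: (@integrable_prod_mul _ _ _ _ _ (@lebesgue_measure R)
    (@lebesgue_measure R) _ _ w0 w0 integrable_weight1 integrable_weight1).
have w2 (x : R * R) : 0 <= (1 + `|x.1|) ^- 2 * (1 + `|x.2|) ^- 2 by rewrite mulr_ge0.
have := @integrable_prod_mul _ _ _ _ _ (@lebesgue_measure2 R)
  (@lebesgue_measure R) _ _ w2 w0 i2 integrable_weight1.
apply: eq_integrable => // x _ /=; congr EFin.
by rewrite /weight3 !invfM !exprMn !exprVn !expr2 !invfM.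
Qed.

End weight.

(** * Convolution with rapidly decaying kernels *)

Section kernels.
Context (R : realType).
Local Notation mu3 := (@lebesgue_measure3 R).
Implicit Types (f g h K : R3 R -> R) (a : R) (x y v xi : R3 R).

Lemma dominated_cvg_Rintegral d (T : measurableType d) (mu : {measure set T -> \bar R})
    (F : nat -> T -> R) (G g : T -> R) :
  (forall n, measurable_fun setT (F n)) -> measurable_fun setT G ->
  mu.-integrable setT (EFin \o g) ->
  (forall n z, `|F n z| <= g z) ->
  (forall z, F n z @[n --> \oo] --> G z) ->
  (\int[mu]_z F n z) @[n --> \oo] --> \int[mu]_z G z.
Proof.
move=> mF mG ig Fg cF.
have Gg z : `|G z| <= g z.
  have cn : `|F n z| @[n --> \oo] --> `|G z| by apply: cvg_norm; exact: cF.
  rewrite -(cvg_lim _ cn)//; apply: limr_le; first by apply/cvg_ex; eexists; exact: cn.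
  by near=> n; exact: Fg.
apply: fine_cvg; rewrite fineK; last first.
  rewrite fin_num_abs; apply: (le_lt_trans (le_abse_integral _ _ _)) => //.
    exact/measurable_EFinP.
  have /integrableP[_] := ig; apply: le_lt_trans.
  apply: ge0_le_integral => //.
  - exact/measurable_EFinP/measurableT_comp.
  - by apply: measurableT_comp => //; case/integrableP : ig.
  - by move=> z _ /=; rewrite lee_fin (le_trans (Gg z))// ler_norm.
apply: (@dominated_cvg _ _ _ mu setT measurableT
    (fun n z => (F n z)%:E) (fun z => (G z)%:E) (EFin \o g)) => //=.
- by move=> n; exact/measurable_EFinP.
- by move=> z _; apply: cvg_EFin; [exact: nearW|exact: cF].
- by move=> n z _; rewrite lee_fin.
Unshelve. all: by end_near. Qed.

Lemma weight3_gt0 x : 0 < weight3 x.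
Proof. by rewrite (lt_le_trans ltr01)// weight3_ge1. Qed.

(** One order of decay per coordinate is what places [K] and all its translates in [L^2]. *)
Definition rapid K := continuous K /\ exists C, forall x, `|K x| <= C / weight3 x.

Lemma dilates_reflect x : dilates mu3 1 (fun y => x - y).
Proof.
have := @dilates_lebesgue3 R x (-1) _; rewrite oppr_eq0 oner_neq0 => /(_ isT).
rewrite normrN1 invr1 expr1n (_ : aff x (-1) = fun y => x - y)//.
by apply/funext => y; rewrite /aff scaleN1r.
Qed.

Lemma L2fun_dilates (k : R) (F : R3 R -> R3 R) f : 0 < k -> dilates mu3 k F ->
  L2fun f -> L2fun (f \o F).
Proof.
move=> k0 dF /Lfun2P[mf fi]; apply/Lfun2P; split.
  by apply: measurableT_comp mf _; case: dF.
exact: (dilates_integrable k0 dF fi).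
Qed.

Lemma rapid_L2fun K : rapid K -> L2fun K.
Proof.
move=> [cK [C hC]].
apply: (Lfun2_le _ (Lfun2_scale C (Lfun2_weight3 R))).
  exact: continuous_measurable3.
by move=> x; rewrite (le_trans (hC x))// ler_norm.
Qed.

Lemma rapid_reflect_L2fun K x : rapid K -> L2fun (fun y => K (x - y)).
Proof.
move=> rK; exact: (L2fun_dilates ltr01 (dilates_reflect x) (rapid_L2fun rK)).
Qed.

Lemma sqnorm_reflect K x : L2fun K -> sqnorm mu3 (fun y => K (x - y)) = sqnorm mu3 K.
Proof.
move=> /Lfun2P[mK _]; rewrite /sqnorm.
rewrite (@dilates_Rintegral R _ _ mu3 1 _ (fun y => K y ^+ 2) ltr01
  (dilates_reflect x)) ?mul1r//.
exact: measurable_funX.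
Qed.

Definition conv3 K f x := \int[mu3]_y (f y * K (x - y)).

(** The squared form of Young's inequality from [L^2] and [L^2] to [L^oo]; reflection and
    translation preserve the norm of the kernel. *)
Lemma conv3_bound K f x : rapid K -> L2fun f ->
  conv3 K f x ^+ 2 <= sqnorm mu3 f * sqnorm mu3 K.
Proof.
move=> rK Lf; rewrite -(sqnorm_reflect x (rapid_L2fun rK)).
exact: cauchy_schwarz Lf (rapid_reflect_L2fun x rK).
Qed.

(** A translation of size at most 1 costs a factor 2 per coordinate. Hence one square-integrable
    function dominates the kernels [K (z - y)] for all [z] near [x]. *)
Lemma weight3_near x y : `|x - y| <= 1 -> weight3 x <= 8 * weight3 y.
Proof.
rewrite norm3_le => /and3P[/= h1 h2 h3].
have E (s t : R) : `|s - t| <= 1 -> 1 + `|s| <= 2 * (1 + `|t|).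
  move=> st; have := ler_normD (s - t) t; rewrite subrK.
  by have := normr_ge0 t; lra.
rewrite /weight3 (_ : 8 * _ = (2 * (1 + `|y.1.1|)) * (2 * (1 + `|y.1.2|)) *
  (2 * (1 + `|y.2|))); last by ring.
by do 2 ?[apply: ler_pM; rewrite ?mulr_ge0 ?addr_ge0//]; exact: E.
Qed.

Lemma continuous_reflect K y : continuous K -> continuous (fun x => K (x - y)).
Proof.
move=> cK x; apply: (@cvg_comp _ _ _ (fun x => x - y) K); last exact: cK.
by apply: cvgB; [exact: cvg_id|exact: cvg_cst].
Qed.

Lemma continuous_conv3 K f : rapid K -> L2fun f -> continuous (conv3 K f).
Proof.
move=> rK Lf x; have [cK [C hC]] := rK.
have C0 : 0 <= C.
  by have := le_trans (normr_ge0 _) (hC 0); rewrite ler_pdivlMr ?weight3_gt0// mul0r.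
have rW : L2fun (fun y => (weight3 (x - y))^-1).
  exact: (L2fun_dilates ltr01 (dilates_reflect x) (Lfun2_weight3 R)).
apply: (@continuous_integral _ _ (fun x y => f y * K (x - y))
  (fun y => `|(8 * C) * (f y * (weight3 (x - y))^-1)|) x 1 ltr01).
- move=> z; apply: measurable_funM; first exact: Lfun2_measurable Lf.
  exact: Lfun2_measurable (rapid_reflect_L2fun z rK).
- by apply: integrable_norm; apply: integrable_cmul; exact: Lfun2_mul_integrable Lf rW.
- move=> z y xz; rewrite !normrM mulrCA ler_wpM2l//.
  apply: le_trans (hC _) _.
  rewrite !ger0_norm ?invr_ge0 ?(ltW (weight3_gt0 _))//.
  rewrite [8 * C]mulrC -mulrA ler_wpM2l//.
  rewrite ler_pdivlMr ?weight3_gt0// mulrC ler_pdivrMr ?weight3_gt0//.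
  apply: weight3_near.
  rewrite (_ : _ - _ = x - z); last by rewrite opprB addrA subrK.
  exact: ltW.
- by move=> y; apply: cvgM; [exact: cvg_cst|exact: continuous_reflect].
Qed.

Lemma test_function_cont_bsupp h : test_function h -> cont_bsupp h.
Proof. by move=> /test_functionP[/(_ [::])[ch _] sh]. Qed.

Lemma rapid_oscint h a : test_function h -> rapid (oscint h a).
Proof.
move=> th; have /test_functionP[/smoothP sh bh] := th.
split; first by apply: continuous_oscint; exact: test_function_cont_bsupp.
by have [C _ hC] := oscint_decay (sh 3%N) bh; exists C => x.
Qed.

Lemma test_functionM h g : smooth g -> test_function h ->
  test_function (fun x => h x * g x).
Proof.
move=> /smoothP sg /test_functionP[/smoothP sh bh]; apply/test_functionP.
split; last exact: bsuppM.
by apply/smoothP => n; exact: CnM.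
Qed.

Lemma smooth_dot3 v : smooth (dot3 v).
Proof. by apply/smoothP => n; exact: Cn_dot3. Qed.

Lemma test_function_scale h (c : R) : c != 0 -> test_function h ->
  test_function (fun x => h (c *: x)).
Proof.
move=> c0 /test_functionP[/smoothP sh [M hM]]; apply/test_functionP; split.
  apply/smoothP => n; rewrite (_ : (fun x => _) = (fun x => h (0 + c *: x))).
    exact: Cn_aff.
  by apply/funext => x; rewrite add0r.
exists (`|c|^-1 * M) => x; rewrite ltr_pdivrMl ?normr_gt0// => Mx.
by apply: hM; rewrite normrZ.
Qed.

(* The kernel is not compactly supported: test against
   [chi (y / n) K (x - y)] and let [n] tend to infinity. *)
Lemma weak_derivative_conv3 (chi : R3 R -> R) (i : 'I_3) f g h a x :
  lp_cutoff chi -> L2fun f -> is_weak_partial i f g -> test_function h ->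
  conv3 (oscint (fun xi => h xi * dot3 (basis_vec R i) xi) (a - pi / 2)) f x =
  conv3 (oscint h a) g x.
Proof.
move=> [tchi _ chi0 _ chi1] Lf [Lg wg] th.
set e := basis_vec R i; set K := oscint h a; set K' := oscint _ _.
have cch := test_function_cont_bsupp th.
have rK : rapid K := rapid_oscint a th.
have rK' : rapid K'.
  by apply: rapid_oscint; apply: test_functionM => //; exact: smooth_dot3.
have /test_functionP[/smoothP schi bchi] := tchi.
have [B hB] := cont_bsupp_bounded (test_function_cont_bsupp tchi).
have cDchi : cont_bsupp ('D_e chi).
  split; last exact: bsupp_derive.
  by apply: (@Cn_continuous _ _ 0); have [_ [_]] := schi 1%N; apply.
have [B' hB'] := cont_bsupp_bounded cDchi.
pose r (n : nat) : R := n.+1%:R^-1.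
have r0 n : r n != 0 by rewrite invr_eq0 pnatr_eq0.
pose th_ (n : nat) y := chi (r n *: y).
pose Ga y := K (x - y).
pose psi n y := th_ n y * Ga y.
have tpsi n : test_function (psi n).
  apply: test_functionM; last exact: test_function_scale.
  apply/smoothP => m; rewrite /Ga (_ : (fun y => _) = fun y => K (x + (-1) *: y)).
    by apply: Cn_aff; exact: Cn_oscint.
  by apply/funext => y; rewrite scaleN1r.
have dGa y : is_derive y e Ga (- K' (x - y)).
  have E : Ga = fun y => K (x + (-1) *: y) by apply/funext => z; rewrite scaleN1r.
  have [d1 d2] := oscint_derive a (x - y) e cch.
  have [d3 d4] := derive_dir_scale (-1) d1.
  rewrite E; apply: DeriveDef; first by rewrite derivable_aff scaleN1r.
  by rewrite derive_aff [(-1) *: y]scaleN1r d4 mulN1r d2.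
have dth n y : is_derive y e (th_ n) (r n * 'D_e chi (r n *: y)).
  have E : th_ n = fun y => chi (0 + r n *: y) by apply/funext => z; rewrite add0r.
  have [_ [dchi _]] := schi 1%N.
  have [d3 d4] := derive_dir_scale (r n) (dchi (r n *: y) e).
  rewrite E; apply: DeriveDef; first by rewrite derivable_aff add0r.
  by rewrite derive_aff add0r.
(* The term where the derivative falls on the cutoff carries the factor [r n] and disappears in the
   limit; the minus sign comes from the reflection [y |-> x - y]. *)
have dpsi n y : partial i (psi n) y =
    r n * 'D_e chi (r n *: y) * Ga y - th_ n y * K' (x - y).
  rewrite /partial -/e; have [_ ->] := is_deriveM (dth n y) (dGa y).
  by rewrite /GRing.scale /=; ring.
have mGa := Lfun2_measurable (rapid_reflect_L2fun x rK).
have mK' := Lfun2_measurable (rapid_reflect_L2fun x rK').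
have mf := Lfun2_measurable Lf.
have mg := Lfun2_measurable Lg.
have cth n : continuous (th_ n).
  by have := test_function_cont_bsupp (test_function_scale (r0 n) tchi) => -[].
have r1 n : `|r n| <= 1 by rewrite ger0_norm ?invr_ge0// invf_le1// ler1n.
have r_cvg : r n @[n --> \oo] --> 0 by exact: cvg_harmonic.
have at0 (F : R3 R -> R) y : continuous F -> F (r n *: y) @[n --> \oo] --> F 0.
  move=> cF.
  have hr : r n *: y @[n --> \oo] --> 0 *: y by exact: cvgZ r_cvg (cvg_cst _).
  rewrite scale0r in hr.
  exact: (cvg_comp _ F hr (cF 0)).
have th_cvg y : th_ n y @[n --> \oo] --> (1 : R).
  rewrite -(chi1 0); first by apply: at0; case: (test_function_cont_bsupp tchi).
  by rewrite /enorm dot3E /= !mulr0 !addr0 sqrtr0 invr_ge0.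
have LK := rapid_reflect_L2fun x rK.
have LK' := rapid_reflect_L2fun x rK'.
have lim1 : (\int[mu3]_y (f y * partial i (psi n) y)) @[n --> \oo] -->
     \int[mu3]_y (f y * - K' (x - y)).
  apply: (@dominated_cvg_Rintegral _ _ mu3 _ _
    (fun y => `|f y * (B' * Ga y)| + `|f y * (B * K' (x - y))|)).
  - move=> n; apply: measurable_funM => //; apply: continuous_measurable3.
    have /test_functionP[/smoothP/(_ 1%N)[_ [_ /(_ e) C0]] _] := tpsi n.
    exact: (@Cn_continuous _ _ 0 ('D_e (psi n)) C0).
  - by apply: measurable_funM => //; exact: measurable_funN.
  - have i1 := integrable_norm (Lfun2_mul_integrable Lf (Lfun2_scale B' LK)).
    have i2 := integrable_norm (Lfun2_mul_integrable Lf (Lfun2_scale B LK')).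
    exact: (integrableD measurableT i1 i2).
  - move=> n y; rewrite dpsi !normrM -mulrDr ler_wpM2l//.
    apply: (le_trans (ler_normB _ _)); rewrite !normrM; apply: lerD.
      rewrite ler_wpM2r// -[leRHS]mul1r ler_pM//.
      exact: le_trans (hB' _) (ler_norm _).
    by rewrite ler_wpM2r//; exact: le_trans (hB _) (ler_norm _).
  - move=> y; apply: cvgM; first exact: cvg_cst.
    under eq_fun do rewrite dpsi.
    have h1 : r n * 'D_e chi (r n *: y) @[n --> \oo] --> 0 * 'D_e chi 0.
      by apply: cvgM => //; exact: (at0 ('D_e chi) y (proj1 cDchi)).
    rewrite mul0r in h1.
    have h2 : (r n * 'D_e chi (r n *: y) * Ga y - th_ n y * K' (x - y)) @[n --> \oo] -->
        0 * Ga y - 1 * K' (x - y).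
      by apply: cvgB; apply: cvgM; try exact: cvg_cst.
    by rewrite mul0r mul1r sub0r in h2.
have lim2 : (\int[mu3]_y (g y * psi n y)) @[n --> \oo] --> \int[mu3]_y (g y * Ga y).
  apply: (@dominated_cvg_Rintegral _ _ mu3 _ _ (fun y => `|g y * (B * Ga y)|)).
  - move=> n; apply: measurable_funM => //; apply: continuous_measurable3.
    by case: (test_function_cont_bsupp (tpsi n)).
  - exact: measurable_funM.
  - exact: (integrable_norm (Lfun2_mul_integrable Lg (Lfun2_scale B LK))).
  - move=> n y; rewrite !normrM ler_wpM2l// ler_wpM2r//.
    exact: le_trans (hB _) (ler_norm _).
  - move=> y; apply: cvgM; first exact: cvg_cst.
    have h2 : psi n y @[n --> \oo] --> 1 * Ga y.
      by apply: cvgM; [exact: th_cvg|exact: cvg_cst].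
    by rewrite mul1r in h2.
have E n : \int[mu3]_y (f y * partial i (psi n) y) = - \int[mu3]_y (g y * psi n y).
  exact: wg.
have lim3 : (\int[mu3]_y (f y * partial i (psi n) y)) @[n --> \oo] -->
    - \int[mu3]_y (g y * Ga y).
  by under eq_fun do rewrite E; exact: cvgN.
have EE : \int[mu3]_y (f y * - K' (x - y)) = - \int[mu3]_y (g y * Ga y).
  rewrite -(cvg_lim (@norm_hausdorff _ _) lim1).
  exact: (cvg_lim (@norm_hausdorff _ _) lim3).
rewrite /conv3 -[RHS]opprK -EE.
rewrite -mulN1r -RintegralZl//.
  by apply: eq_Rintegral => y _; rewrite mulN1r mulrN opprK.
have := Lfun2_mul_integrable Lf (Lfun2_scale (-1) LK').
by apply: eq_integrable => // y _ /=; rewrite mulN1r.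
Qed.

End kernels.

(** * A Bernstein inequality *)

Section bernstein.
Context (R : realType) (chi : R3 R -> R).
Hypothesis hchi : lp_cutoff chi.
Local Notation mu3 := (@lebesgue_measure3 R).
Implicit Types (f g h : R3 R -> R) (a : R) (x y v xi : R3 R).

Lemma enormZ (c : R) x : enorm (c *: x) = `|c| * enorm x.
Proof.
have E : dot3 (c *: x) (c *: x) = c ^+ 2 * dot3 x x.
  by rewrite !dot3E /= /GRing.scale /=; ring.
by rewrite /enorm E sqrtrM ?sqr_ge0// sqrtr_sqr.
Qed.

Lemma dot3Z v (c : R) x : dot3 v (c *: x) = c * dot3 v x.
Proof. by rewrite !dot3E /= /GRing.scale /=; ring. Qed.

Lemma dot3_ge0 x : 0 <= dot3 x x.
Proof. by rewrite dot3E -!expr2 !addr_ge0// sqr_ge0. Qed.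

Lemma test_function_smooth h : test_function h -> forall n, Cn n h.
Proof. by move=> /test_functionP[/smoothP]. Qed.

Lemma bsuppB f g : bsupp f -> bsupp g -> bsupp (fun x => f x - g x).
Proof.
move=> [M hM] [N hN]; exists (Num.max M N) => x; rewrite gt_max => /andP[Mx Nx].
by rewrite hM// hN// subrr.
Qed.

(** The Littlewood-Paley function at unit frequency; [lp_phi chi q] is its dilation by
    [lambda q]. *)
Definition annulus_cutoff xi : R := chi (2^-1 *: xi) - chi xi.

Lemma test_function_annulus : test_function annulus_cutoff.
Proof.
have [tchi _ _ _ _] := hchi.
have n2 : (2^-1 : R) != 0 by rewrite invr_eq0 pnatr_eq0.
have t2 := test_function_scale n2 tchi.
apply/test_functionP; split.
  by apply/smoothP => n; apply: CnB; exact: test_function_smooth.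
by apply: bsuppB; [have /test_functionP[] := t2|have /test_functionP[] := tchi].
Qed.

(* Equal to [|xi|^2] on the support of [annulus_cutoff], but positive (hence
   smoothly invertible) also at the origin. *)
Definition denominator xi : R := dot3 xi xi + chi (2 *: xi).

Lemma denominator_gt0 xi : 0 < denominator xi.
Proof.
have [_ _ chi0 _ chi1] := hchi.
(* For [|xi| <= 1/4] the added bump equals 1; elsewhere [|xi|^2] is already positive. *)
rewrite /denominator; have [le4|gt4] := lerP (enorm xi) (4^-1).
  rewrite chi1 ?ltr_wpDl ?dot3_ge0// enormZ ger0_norm//; lra.
rewrite ltr_pwDl//.
by rewrite -sqrtr_gt0 -/(enorm xi) (lt_trans _ gt4)// invr_gt0.
Qed.

(** For [|xi| <= 1/2] both cutoffs equal 1 and [annulus_cutoff] vanishes; for [|xi| > 1/2] the point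
    [2 xi] is outside the support of [chi], so the denominator is [|xi|^2]. *)
Lemma annulusE xi : annulus_cutoff xi * (dot3 xi xi / denominator xi) = annulus_cutoff xi.
Proof.
have [tchi schi chi0 _ chi1] := hchi.
have [le2|gt2] := lerP (enorm xi) (2^-1).
  rewrite /annulus_cutoff !chi1 ?subrr ?mul0r// enormZ ger0_norm ?invr_ge0//; lra.
suff c0 : chi (2 *: xi) = 0.
  have := denominator_gt0 xi; rewrite /denominator c0 addr0 => d0.
  by rewrite divff ?mulr1// gt_eqF.
apply/eqP/negPn/negP => cn0.
have : fun_supp chi (2 *: xi) by apply: subset_closure.
by move/schi => /=; rewrite enormZ ger0_norm//; lra.
Qed.

(** The symbol of [d_i] composed with the inverse Laplacian, localised to the annulus; its factor
    [i] is left to the phase of [oscint]. *)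
Definition riesz_part (i : 'I_3) xi : R :=
  annulus_cutoff xi * (dot3 (basis_vec R i) xi / denominator xi).

Lemma Cn_dot3_sq n : Cn n (fun xi => dot3 xi xi).
Proof.
have e1 v : Cn n (fun xi => dot3 v xi * dot3 v xi) by apply: CnM; exact: Cn_dot3.
rewrite (_ : (fun xi => _) = (fun xi => dot3 ((1,0),0) xi * dot3 ((1,0),0) xi)
  \+ (fun xi => dot3 ((0,1),0) xi * dot3 ((0,1),0) xi)
  \+ (fun xi => dot3 ((0,0),1) xi * dot3 ((0,0),1) xi)).
  by apply: CnD => //; apply: CnD.
by apply/funext => xi; rewrite /= !dot3E /=; ring.
Qed.

Lemma test_function_riesz i : test_function (riesz_part i).
Proof.
have [tchi _ _ _ _] := hchi.
apply: test_functionM; last exact: test_function_annulus.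
apply/smoothP => n; apply: CnM; first exact: Cn_dot3.
apply: CnV; first by move=> xi; rewrite gt_eqF// denominator_gt0.
apply: CnD; first exact: Cn_dot3_sq.
by apply: test_function_smooth; apply: test_function_scale => //; rewrite pnatr_eq0.
Qed.

Lemma sum3 (F : 'I_3 -> R) (i0 : (0 < 3)%N) (i1 : (1 < 3)%N) (i2 : (2 < 3)%N) :
  \sum_(i < 3) F i = F (Ordinal i0) + F (Ordinal i1) + F (Ordinal i2).
Proof.
rewrite !big_ord_recr big_ord0 /= add0r.
by congr (F _ + F _ + F _); apply: val_inj.
Qed.

Lemma riesz_sum xi :
  annulus_cutoff xi = \sum_(i < 3) riesz_part i xi * dot3 (basis_vec R i) xi.
Proof.
rewrite -[LHS]annulusE !big_ord_recr big_ord0 /= add0r /riesz_part.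
rewrite !dot3E /= !mul1r !mul0r !addr0 !add0r.
by have := denominator_gt0 xi => d0; field; rewrite gt_eqF.
Qed.

Lemma lambda_gt0 q : 0 < lambda R q.
Proof. by rewrite exprn_gt0. Qed.

(** The prefactor compensates the degree -1 of [xi_i / |xi|^2], so that the profile is
    [xi_i phi_q(xi) / |xi|^2]. *)
Definition riesz_scaled q i xi : R :=
  (lambda R q)^-1 * riesz_part i ((lambda R q)^-1 *: xi).

Lemma test_function_cmul (c : R) h : test_function h ->
  test_function (fun xi => c * h xi).
Proof.
move=> /test_functionP[/smoothP sh [M hM]]; apply/test_functionP; split.
  by apply/smoothP => n; exact: CnZ.
by exists M => x /hM ->; rewrite mulr0.
Qed.

Lemma test_function_riesz_scaled q i : test_function (riesz_scaled q i).
Proof.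
apply: test_function_cmul; apply: test_function_scale; last exact: test_function_riesz.
by rewrite invr_eq0 gt_eqF// lambda_gt0.
Qed.

Lemma lp_phi_sum q xi :
  lp_phi chi q xi = \sum_(i < 3) riesz_scaled q i xi * dot3 (basis_vec R i) xi.
Proof.
rewrite [LHS]riesz_sum; apply: eq_bigr => i _.
by rewrite /riesz_scaled dot3Z mulrCA mulrA.
Qed.

Lemma oscintZ (c : R) h a x : cont_bsupp h ->
  oscint (fun xi => c * h xi) a x = c * oscint h a x.
Proof.
move=> cch; rewrite /oscint -RintegralZl//; last first.
  by apply: cont_bsupp_integrable; exact: cont_bsupp_phase.
by apply: eq_Rintegral => xi _; rewrite mulrA.
Qed.

Lemma oscintD f g a x : cont_bsupp f -> cont_bsupp g ->
  oscint (fun xi => f xi + g xi) a x = oscint f a x + oscint g a x.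
Proof.
move=> cf cg; rewrite /oscint -RintegralD//;
  [|by apply: cont_bsupp_integrable; exact: cont_bsupp_phase..].
by apply: eq_Rintegral => xi _; rewrite mulrDl.
Qed.

Lemma cont_bsuppD f g : cont_bsupp f -> cont_bsupp g -> cont_bsupp (fun x => f x + g x).
Proof.
move=> [cf [M hM]] [cg [N hN]]; split.
  by move=> x; apply: cvgD; [exact: cf|exact: cg].
exists (Num.max M N) => x; rewrite gt_max => /andP[Mx Nx].
by rewrite hM// hN// addr0.
Qed.

Lemma rapidD (K K' : R3 R -> R) : rapid K -> rapid K' -> rapid (fun x => K x + K' x).
Proof.
move=> [cK [C hC]] [cK' [C' hC']]; split.
  by move=> x; apply: cvgD; [exact: cK|exact: cK'].
exists (C + C') => x; rewrite mulrDl.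
by rewrite (le_trans (ler_normD _ _))// lerD.
Qed.

Lemma conv3D (K K' : R3 R -> R) f x : rapid K -> rapid K' -> L2fun f ->
  conv3 (fun z => K z + K' z) f x = conv3 K f x + conv3 K' f x.
Proof.
move=> rK rK' Lf; rewrite /conv3 -RintegralD//; last 2 first.
- exact: Lfun2_mul_integrable Lf (rapid_reflect_L2fun x rK).
- exact: Lfun2_mul_integrable Lf (rapid_reflect_L2fun x rK').
by apply: eq_Rintegral => y _; rewrite mulrDr.
Qed.

(** The prefactor gives [lambda^-1] and the frequency dilation [lambda^3]; squaring yields
    [lambda^4], and the change of variables in space returns [lambda^-3]. *)
Lemma sqnorm_riesz_scaled q i a :
  sqnorm mu3 (oscint (riesz_scaled q i) a) =
    lambda R q * sqnorm mu3 (oscint (riesz_part i) a).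
Proof.
have l0 := lambda_gt0 q.
have l1 : lambda R q != 0 by rewrite gt_eqF.
have tr := test_function_riesz i.
have cr := test_function_cont_bsupp tr.
have E x : oscint (riesz_scaled q i) a x ^+ 2 =
    lambda R q ^+ 4 * oscint (riesz_part i) a (aff 0 (lambda R q) x) ^+ 2.
  rewrite /riesz_scaled oscintZ; last first.
    by apply: test_function_cont_bsupp; apply: test_function_scale => //; rewrite invr_eq0.
  by rewrite oscint_scale// /aff add0r; field.
rewrite /sqnorm; under eq_Rintegral do rewrite E.
have Lr := rapid_L2fun (rapid_oscint a tr).
have dl := dilates_lebesgue3 0 l1.
have p0 : 0 < `|lambda R q|^-1 ^+ 3 by rewrite exprn_gt0// invr_gt0 normr_gt0.
have /Lfun2P[_ ir] := Lr.
rewrite (RintegralZl _ measurableT (dilates_integrable p0 dl ir)).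
rewrite (@dilates_Rintegral R _ _ mu3 _ _
  (fun x => oscint (riesz_part i) a x ^+ 2) p0 dl).
  by rewrite gtr0_norm//; field.
by apply: measurable_funX; exact: Lfun2_measurable Lr.
Qed.

(** The 3 comes from Cauchy-Schwarz on three terms; the six cross products [l c_i s_j] are
    nonnegative and enlarge the diagonal sum to a product of sums. *)
Lemma sqr_sum3_le (k0 k1 k2 c0 c1 c2 s0 s1 s2 l : R) :
  0 <= c0 -> 0 <= c1 -> 0 <= c2 -> 0 <= s0 -> 0 <= s1 -> 0 <= s2 -> 0 <= l ->
  k0 ^+ 2 <= s0 * (l * c0) -> k1 ^+ 2 <= s1 * (l * c1) -> k2 ^+ 2 <= s2 * (l * c2) ->
  (k0 + k1 + k2) ^+ 2 <= 3 * (c0 + c1 + c2) * l * (s0 + s1 + s2).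
Proof.
move=> c00 c10 c20 s00 s10 s20 l0 h0 h1 h2.
have P (c s : R) : 0 <= c -> 0 <= s -> 0 <= l * (c * s) by move=> *; rewrite !mulr_ge0.
have := P _ _ c00 s10; have := P _ _ c00 s20; have := P _ _ c10 s00.
have := P _ _ c10 s20; have := P _ _ c20 s00; have := P _ _ c20 s10.
have H : (k0 + k1 + k2) ^+ 2 <= 3 * (k0 ^+ 2 + k1 ^+ 2 + k2 ^+ 2).
  have := sqr_ge0 (k0 - k1); have := sqr_ge0 (k0 - k2); have := sqr_ge0 (k1 - k2).
  by lra.
by lra.
Qed.

(* [u_q = sum_i G_i * (d_i u)] where [G_i] has frequency profile
   [riesz_scaled q i] up to a constant phase, and [||G_i||_2^2] is of order
   [lambda_q] by scaling. *)
Lemma bernstein a : exists2 C, 0 <= C & forall q f (g : 'I_3 -> R3 R -> R) x,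
  L2fun f -> (forall i, is_weak_partial i f (g i)) ->
  conv3 (oscint (lp_phi chi q) a) f x ^+ 2 <=
    C * lambda R q * \sum_(i < 3) sqnorm mu3 (g i).
Proof.
(* Differentiating a kernel of phase [b] brings its phase to [a]. *)
pose b := a + pi / 2.
pose c i := sqnorm mu3 (oscint (riesz_part i) b).
have c0 i : 0 <= c i by exact: sqnorm_ge0.
exists (3 * \sum_(i < 3) c i) => [|q f g x Lf wg].
  by rewrite mulr_ge0// sumr_ge0.
have ab : b - pi / 2 = a by rewrite /b addrK.
pose K i := oscint (fun xi => riesz_scaled q i xi * dot3 (basis_vec R i) xi) a.
have tK i : test_function (fun xi => riesz_scaled q i xi * dot3 (basis_vec R i) xi).
  by apply: test_functionM; [exact: smooth_dot3|exact: test_function_riesz_scaled].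
have rK i : rapid (K i) by exact: rapid_oscint.
have BK i : conv3 (K i) f x ^+ 2 <= sqnorm mu3 (g i) * (lambda R q * c i).
  rewrite /K -ab.
  rewrite (weak_derivative_conv3 b x hchi Lf (wg i) (test_function_riesz_scaled q i)).
  rewrite /c -sqnorm_riesz_scaled; apply: conv3_bound; last by case: (wg i).
  by apply: rapid_oscint; exact: test_function_riesz_scaled.
have cK i := test_function_cont_bsupp (tK i).
have [i0 i1 i2] : [/\ (0 < 3)%N, (1 < 3)%N & (2 < 3)%N] by [].
have E : oscint (lp_phi chi q) a =
    fun z => K (Ordinal i0) z + K (Ordinal i1) z + K (Ordinal i2) z.
  apply/funext => z; rewrite /K -oscintD// -oscintD//; last exact: cont_bsuppD.
  congr oscint; apply/funext => xi; rewrite lp_phi_sum; exact: sum3.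
have rKK : rapid (fun z => K (Ordinal i0) z + K (Ordinal i1) z) by exact: rapidD.
rewrite E !conv3D//.
rewrite !(sum3 _ i0 i1 i2).
have := (BK (Ordinal i0), BK (Ordinal i1), BK (Ordinal i2)).
move=> [[b0 b1] b2].
have s0 i := sqnorm_ge0 mu3 (g i).
have l0 := lambda_gt0 q.
exact: (sqr_sum3_le (c0 _) (c0 _) (c0 _) (s0 _) (s0 _) (s0 _) (ltW l0) b0 b1 b2).
Qed.

End bernstein.

(** * The dissipation wavenumber *)

Section sup_norm.
Context (R : realType).
Local Notation mu3 := (@lebesgue_measure3 R).

Lemma lebesgue_ball3_gt0 (x : R3 R) (e : R) : 0 < e ->
  measurable (ball x e : set (M3 R)) /\ (0 < mu3 (ball x e))%E.
Proof.
move=> e0.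
have -> : ball x e = ball x.1.1 e `*` ball x.1.2 e `*` ball x.2 e.
  by apply/seteqP; split => [y [[? ?] ?]|y [[? ?] ?]]; split => //; split.
have mb (y : R) : measurable (ball y e : set (measurableTypeR R)) by exact: measurable_ball.
have pb (y : R) : (0 < @lebesgue_measure R (ball y e : set R))%E.
  by rewrite lebesgue_measure_ball ?ltW// lte_fin pmulrn_lgt0.
split; first by apply: measurableX => //; apply: measurableX.
rewrite /lebesgue_measure3 product_measure1E//; last exact: measurableX.
rewrite mule_gt0 ?pb//.
rewrite -[X in (_ < X)%E]/((@lebesgue_measure R \x @lebesgue_measure R)%E
  (ball x.1.1 e `*` ball x.1.2 e)).
rewrite product_measure1E//; apply: mule_gt0; exact: pb.
Qed.

(** A strict violation at one point persists on a ball, and balls have positive measure. *)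
Lemma ae_le_continuous (F : R3 R -> R) (a : \bar R) : continuous F ->
  {ae mu3, forall x, ((F x)%:E <= a)%E} -> forall x, ((F x)%:E <= a)%E.
Proof.
move=> cF [N [mN N0 FN]] x; rewrite leNgt; apply/negP => aF.
have [e e0 eF] : exists2 e, 0 < e & forall y, ball x e y -> (a < (F y)%:E)%E.
  have : \forall y \near x, (a < (F y)%:E)%E.
    case: a aF {FN} => [r| |].
    - rewrite lte_fin => rF.
      have h : \forall y \near x, r < F y by exact: (@cvgr_gt _ _ _ _ F (F x) (cF x) _ rF).
      by apply: filterS h => y; rewrite lte_fin.
    - by rewrite ltNge leey.
    - by move=> _; apply/nbhs_ballP; exists 1 => //= y _; rewrite ltNyr.
  by move=> /nbhs_ballP[e /= e0 eF]; exists e.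
have [mb pb] := lebesgue_ball3_gt0 x e0.
have : (mu3 (ball x e) <= mu3 N)%E.
  rewrite le_measure ?inE// => y /eF aFy; apply: FN => /= Fya.
  by move: aFy; rewrite ltNge Fya.
by rewrite N0 leNgt pb.
Qed.

Lemma lebesgue3_setT_gt0 : (0 < mu3 setT)%E.
Proof.
have [mb pb] := @lebesgue_ball3_gt0 0 1 ltr01.
by apply: (lt_le_trans pb); apply: le_measure => //; apply/mem_set => //.
Qed.

Lemma Lnormy_leP (F : R3 R -> R) (a : \bar R) : continuous F -> (forall x, 0 <= F x) ->
  (Lnorm mu3 +oo%E (EFin \o F) <= a)%E <-> forall x, ((F x)%:E <= a)%E.
Proof.
move=> cF F0.
(* The norm of exponent [+oo] is the essential supremum only on a space of positive measure. *)
rewrite unlock /= lebesgue3_setT_gt0.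
have E : (abse \o (EFin \o F)) = EFin \o F.
  by apply/funext => x /=; rewrite ger0_norm.
rewrite E; split => [/ess_supP|h]; first exact: ae_le_continuous.
by apply/ess_supP; apply: aeW.
Qed.

(** Links the real sums of the Bernstein bound to the extended norm. Square integrability makes each
    [sqnorm] a true integral, not the default value of [fine]. *)
Lemma sqnorm_le_l2_norm (I : finType) (w : I -> R3 R -> R) : L2field w ->
  ((\sum_(k : I) sqnorm mu3 (w k))%:E <= l2_norm w ^+ 2)%E.
Proof.
move=> Lw.
have E : ((l2_norm w) ^+ 2 = \int[mu3]_x (\sum_(k : I) w k x ^+ 2)%:E)%E.
  have : (l2_norm w `^ 2 = \int[mu3]_x (\sum_(k : I) w k x ^+ 2)%:E)%E.
    rewrite poweR_Lnorm//; apply: eq_integral => x _.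
    rewrite /= ger0_norm ?sqrtr_ge0// powR_mulrn ?sqrtr_ge0// sqr_sqrtr//.
    by apply: sumr_ge0 => k _; exact: sqr_ge0.
  move=> <-.
  have := Lnorm_ge0 mu3 2%:E (fun x => (Num.sqrt (\sum_(k : I) w k x ^+ 2))%:E).
  rewrite -/(l2_norm w); case: (l2_norm w) => [r| |].
  - by rewrite lee_fin => r0; rewrite poweR_EFin powR_mulrn.
  - by move=> _; rewrite poweRyr// expe2.
  - by [].
rewrite E; under eq_integral do rewrite -sumEFin.
rewrite ge0_integral_sum//; last 2 first.
- move=> k; apply/measurable_EFinP; apply: measurable_funX.
  exact: Lfun2_measurable (Lw k).
- by move=> k x _; rewrite lee_fin sqr_ge0.
rewrite -sumEFin; apply: lee_sum => k _.
rewrite /sqnorm /Rintegral fineK//.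
have /Lfun2P[_ ik] := Lw k.
exact: (integrable_fin_num measurableT ik).
Qed.

End sup_norm.

(** * Littlewood-Paley pieces as real convolutions *)

Section lp_projection.
Context (R : realType).
Local Notation mu3 := (@lebesgue_measure3 R).
Local Open Scope complex_scope.

(** The profile and the field are real, so real and imaginary parts separate: cosine is phase 0 and
    sine is phase [pi / 2]. *)
Lemma lp_projE (chi : R3 R -> R) q (v : 'I_3 -> R3 R -> R) i x :
  lp_cutoff chi -> L2field v ->
  lp_proj chi q v i x =
    (((2 * pi) ^+ 3)^-1 * conv3 (oscint (lp_phi chi q) 0) (v i) x)
    +i* (((2 * pi) ^+ 3)^-1 * conv3 (oscint (lp_phi chi q) (pi / 2)) (v i) x).
Proof.
move=> hchi Lv.
have tphi : test_function (lp_phi chi q).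
  have l0 : (lambda R q)^-1 != 0 by rewrite invr_eq0 gt_eqF// lambda_gt0.
  exact: (test_function_scale l0 (test_function_annulus hchi)).
have IF z : inv_fourier (fun xi => (lp_phi chi q xi)%:C) z =
    (((2 * pi) ^+ 3)^-1 * oscint (lp_phi chi q) 0 z)
    +i* (((2 * pi) ^+ 3)^-1 * oscint (lp_phi chi q) (pi / 2) z).
  rewrite /inv_fourier /complex_integral /=; simpc.
  congr (_ +i* _); congr (_ * _); apply: eq_Rintegral => xi _;
    rewrite /= ?mul0r ?subr0 ?addr0.
  - by [].
  - by rewrite cosBpihalf.
rewrite /lp_proj /convolution /complex_integral.
congr (_ +i* _); rewrite /conv3 -RintegralZl//.
- by apply: eq_Rintegral => y _; rewrite IF /= !mulr0 subr0; ring.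
- exact: Lfun2_mul_integrable (Lv i) (rapid_reflect_L2fun x (rapid_oscint _ tphi)).
- by apply: eq_Rintegral => y _; rewrite IF /= !mulr0 add0r; ring.
- exact: Lfun2_mul_integrable (Lv i) (rapid_reflect_L2fun x (rapid_oscint _ tphi)).
Qed.

End lp_projection.

(** * Pointwise-in-time bound on the wavenumber *)

Section wavenumber.
Context (R : realType) (chi : R3 R -> R).
Hypothesis hchi : lp_cutoff chi.
Local Notation mu3 := (@lebesgue_measure3 R).
Implicit Types (v : 'I_3 -> R3 R -> R) (x : R3 R).
Local Notation cst_fourier := (((2 * pi : R) ^+ 3)^-1).

Definition lp_part q a v i x : R := cst_fourier * conv3 (oscint (lp_phi chi q) a) (v i) x.

(** The modulus of the complex vector [u_q] at the point [x], expressed through six real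
    convolutions. *)
Definition lp_size q v x : R :=
  Num.sqrt (\sum_(i < 3) (lp_part q 0 v i x ^+ 2 + lp_part q (pi / 2) v i x ^+ 2)).

Lemma test_function_lp_phi q : test_function (lp_phi chi q).
Proof.
have l0 : (lambda R q)^-1 != 0 by rewrite invr_eq0 gt_eqF// lambda_gt0.
exact: (test_function_scale l0 (test_function_annulus hchi)).
Qed.

Lemma linf_normE q v : L2field v ->
  linf_norm (lp_proj chi q v) = Lnorm mu3 +oo%E (EFin \o lp_size q v).
Proof.
move=> Lv; rewrite /linf_norm; congr (Lnorm _ _ _); apply/funext => x.
congr (Num.sqrt _)%:E; apply: eq_bigr => i _.
by rewrite lp_projE// [LHS]sqr_sqrtr// addr_ge0// sqr_ge0.
Qed.

Lemma continuous_sqrt_sum (T : topologicalType) (F G : 'I_3 -> T -> R) :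
  (forall i, continuous (F i)) -> (forall i, continuous (G i)) ->
  continuous (fun z => Num.sqrt (\sum_(i < 3) (F i z ^+ 2 + G i z ^+ 2))).
Proof.
move=> cF cG z.
apply: (@cvg_comp _ _ _ (fun z => \sum_(i < 3) (F i z ^+ 2 + G i z ^+ 2))
  (@Num.sqrt R)); last exact: sqrt_continuous.
have c i : (F i w ^+ 2 + G i w ^+ 2) @[w --> z] --> F i z ^+ 2 + G i z ^+ 2.
  by apply: cvgD; apply: cvgM; try exact: cF; exact: cG.
have [i0 i1 i2] : [/\ (0 < 3)%N, (1 < 3)%N & (2 < 3)%N] by [].
rewrite (sum3 _ i0 i1 i2); under eq_fun do rewrite (sum3 _ i0 i1 i2).
by apply: cvgD => //; apply: cvgD.
Qed.

Lemma continuous_lp_part q a v i : L2field v -> continuous (lp_part q a v i).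
Proof.
move=> Lv x; apply: cvgM; first exact: cvg_cst.
apply: continuous_conv3; last exact: Lv.
by apply: rapid_oscint; exact: test_function_lp_phi.
Qed.

Lemma linf_norm_leP q v (a : \bar R) : L2field v ->
  (linf_norm (lp_proj chi q v) <= a)%E <-> forall x, ((lp_size q v x)%:E <= a)%E.
Proof.
move=> Lv; rewrite linf_normE//; apply: Lnormy_leP; last by move=> x; exact: sqrtr_ge0.
by apply: continuous_sqrt_sum => i; exact: continuous_lp_part.
Qed.

Lemma weak_gradP v i j : H1field v -> is_weak_partial j (v i) (weak_grad v (i, j)).
Proof. by move=> /(_ i)[_ /(_ j) ex]; exact: (xgetPex _ ex). Qed.

Lemma lp_size_bound : exists2 C, 0 <= C & forall q v x, H1field v ->
  lp_size q v x ^+ 2 <= C * lambda R q * \sum_k sqnorm mu3 (weak_grad v k).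
Proof.
have [C0 C00 B0] := bernstein hchi 0.
have [C1 C10 B1] := bernstein hchi (pi / 2).
(* [C0] controls the real parts, [C1] the imaginary parts, and the Fourier normalisation enters
   squared. *)
exists (cst_fourier ^+ 2 * (C0 + C1)) => [|q v x Hv].
  by rewrite mulr_ge0 ?sqr_ge0// addr_ge0.
rewrite sqr_sqrtr; last by apply: sumr_ge0 => i _; rewrite addr_ge0// sqr_ge0.
rewrite (_ : \sum_k sqnorm mu3 (weak_grad v k) =
   \sum_(i < 3) \sum_(j < 3) sqnorm mu3 (weak_grad v (i, j))); last first.
  by rewrite pair_bigA /=; apply: eq_bigr => -[].
rewrite mulr_sumr; apply: ler_sum => i _.
have Lvi : L2fun (v i) by case: (Hv i).
have wg j := weak_gradP i j Hv.
have b0 := B0 q (v i) (fun j => weak_grad v (i, j)) x Lvi wg.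
have b1 := B1 q (v i) (fun j => weak_grad v (i, j)) x Lvi wg.
rewrite /lp_part; move: cst_fourier => k; rewrite !exprMn -mulrDr.
set S := \sum_(j < 3) _ in b0 b1 *.
apply: (@le_trans _ _ (k ^+ 2 * (C0 * lambda R q * S + C1 * lambda R q * S))).
  by rewrite ler_wpM2l ?sqr_ge0// lerD.
by rewrite le_eqVlt; apply/orP; left; apply/eqP; ring.
Qed.

Lemma lambda_le p q : (p <= q)%N -> lambda R p <= lambda R q.
Proof. by move=> pq; rewrite ler_weXn2l// ler1n. Qed.

Lemma wavenumber_ge0 (c0 nu : R) v : (0 <= dissipation_wavenumber chi c0 nu v)%E.
Proof.
by apply: le_ereal_inf_tmp => _ [q _ <-]; rewrite lee_fin ltW// lambda_gt0.
Qed.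

(* Take for [q + 1] the least [n] with [X < lambda_n]. *)
Lemma wavenumber_le (c0 nu : R) v (X : R) : 0 <= X ->
  (forall p, X < lambda R p ->
    (((lambda R p)^-1)%:E * linf_norm (lp_proj chi p v) < (c0 * nu)%:E)%E) ->
  (dissipation_wavenumber chi c0 nu v <= (1 + X)%:E)%E.
Proof.
move=> X0 HX.
have ex : exists n, X < lambda R n.
  by exists (Num.bound X); exact: upper_nthrootP.
case: (ex_minnP ex) => n Xn nmin.
apply: (@le_trans _ _ (lambda R n.-1)%:E).
  apply: ereal_inf_lbound; exists n.-1 => //= p np; apply: HX.
  by rewrite (lt_le_trans Xn)// lambda_le//; case: n np {Xn nmin}.
(* For [n = 0] the witness is [q = 0] and the 1 in the bound absorbs [lambda 0 = 1]; otherwise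
   minimality gives [lambda (n - 1) <= X]. *)
rewrite lee_fin; case: n Xn nmin => [|n] Xn nmin.
  by rewrite /lambda expr0 lerDl.
rewrite /= (@le_trans _ _ X)// ?lerDr//.
by rewrite leNgt; apply/negP => /nmin; rewrite ltnn.
Qed.

Lemma wavenumber_bound (c0 nu : R) : 0 < c0 -> 0 < nu -> exists2 C, 0 <= C &
  forall v, H1field v ->
    (dissipation_wavenumber chi c0 nu v <= 1%:E + C%:E * h1_norm_sq v)%E.
Proof.
move=> c00 nu0; have cn : 0 < c0 * nu by exact: mulr_gt0.
have [C C0 HC] := lp_size_bound.
exists (C / (c0 * nu) ^+ 2) => [|v Hv]; first by rewrite divr_ge0// sqr_ge0.
have Lv : L2field v by move=> i; case: (Hv i).
have Lg : L2field (weak_grad v) by move=> [i j]; case: (weak_gradP i j Hv).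
set G := \sum_k sqnorm mu3 (weak_grad v k).
have G0 : 0 <= G by apply: sumr_ge0 => k _; exact: sqnorm_ge0.
pose X := C / (c0 * nu) ^+ 2 * G.
have X0 : 0 <= X by rewrite mulr_ge0// divr_ge0// sqr_ge0.
apply: (@le_trans _ _ (1 + X)%:E).
  apply: wavenumber_le => // p Xp.
  have l0 := lambda_gt0 R p.
  set s := Num.sqrt (C * lambda R p * G).
  apply: (@le_lt_trans _ _ ((lambda R p)^-1 * s)%:E).
    rewrite EFinM lee_wpmul2l ?lee_fin ?invr_ge0 ?(ltW l0)//.
    apply/(linf_norm_leP p s%:E Lv) => x; rewrite lee_fin -[leLHS]ger0_norm ?sqrtr_ge0//.
    by rewrite -sqrtr_sqr ler_wsqrtr// HC.
  rewrite lte_fin mulrC ltr_pdivrMr// -[ltRHS]ger0_norm ?mulr_ge0 ?ltW//.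
  rewrite -sqrtr_sqr ltr_sqrt ?exprn_gt0 ?mulr_gt0//.
  (* After squaring, the goal is [X < lambda p] multiplied by [lambda p * (c0 * nu) ^ 2]. *)
  move: Xp; rewrite /X mulrAC ltr_pdivrMr ?exprn_gt0// => Xp.
  have := Xp; rewrite -(ltr_pM2l l0) exprMn => h; lra.
rewrite EFinD leeD2l// /X EFinM lee_wpmul2l ?lee_fin ?divr_ge0 ?sqr_ge0//.
rewrite (le_trans (sqnorm_le_l2_norm Lg))// /h1_norm_sq leeDr//.
by rewrite expe2 mule_ge0// Lnorm_ge0.
Qed.

End wavenumber.

(** * Measurability of the wavenumber in time *)

Section measurability.
Context (R : realType) (chi : R3 R -> R).
Hypothesis hchi : lp_cutoff chi.
Local Notation mu3 := (@lebesgue_measure3 R).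
Local Notation leb := (@lebesgue_measure R).
Variables (T : R) (u : R -> 'I_3 -> R3 R -> R).
Hypothesis wu : weakly_continuous T u.

(** A relatively closed subset of the closed set [A] is closed in the line. *)
Lemma closed_within_le (A : set R) (S : R -> R) (a : R) : closed A ->
  {within A, continuous S} -> closed (A `&` [set t | S t <= a]).
Proof.
move=> cA cS.
have : closed ((S : subspace A -> R) @^-1` [set y | y <= a]).
  by apply: preimage_closed => [t _|]; [exact: cS|exact: closed_le].
move=> /closed_subspaceP[V cV VA].
by rewrite setIC -[_ `&` A]VA; exact: closedI.
Qed.

(** Lets weak continuity, stated for vector fields, act on a single component. *)
Lemma l2_inner_single (v : 'I_3 -> R3 R -> R) i (K : R3 R -> R) :
  l2_inner v (fun j y => (j == i)%:R * K y) = \int[mu3]_y (v i y * K y).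
Proof.
rewrite /l2_inner (bigD1 i)//= big1 ?addr0.
  by apply: eq_Rintegral => y _; rewrite eqxx mul1r.
move=> j /negbTE ->; under eq_Rintegral do rewrite mul0r mulr0.
by rewrite /Rintegral integral0.
Qed.

(** At a fixed point [x] the convolution is the pairing of [u t] with the reflected kernel, a
    square-integrable field independent of [t]. *)
Lemma within_continuous_lp_part q a i x :
  {within `[0, T], continuous (fun t => lp_part chi q a (u t) i x)}.
Proof.
have rK := rapid_oscint a (test_function_lp_phi hchi q).
pose w (j : 'I_3) y := (j == i)%:R * oscint (lp_phi chi q) a (x - y).
have Lw : L2field w.
  by move=> j; apply: Lfun2_scale; exact: rapid_reflect_L2fun.
have cw := wu.2 w Lw.
rewrite (_ : (fun t => _) = (fun t => (((2 * pi) ^+ 3)^-1) * l2_inner (u t) w)).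
  by move=> t; apply: cvgM; [exact: cvg_cst|exact: cw].
by apply/funext => t; rewrite /w l2_inner_single.
Qed.

Lemma within_continuous_lp_size q x :
  {within `[0, T], continuous (fun t => lp_size chi q (u t) x)}.
Proof.
apply: continuous_sqrt_sum => i; exact: within_continuous_lp_part.
Qed.

Let D : set R := `]0, T[.

Let sub_D t : D t -> t \in `[0, T].
Proof. by rewrite /D /= !in_itv /= => /andP[t0 tT]; rewrite !ltW. Qed.

(* The sublevel sets are relatively closed: [|u_q(t)|_oo <= a] iff
   [|u_q(t, x)| <= a] for every [x], and [u_q(., x)] is continuous. *)
Lemma measurable_linf_norm q :
  measurable_fun D (fun t => linf_norm (lp_proj chi q (u t))).
Proof.
apply: (measurability _ (ErealGenOInfty.measurableE R)) => _ [_ [a ->] <-].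
rewrite (_ : _ `&` _ = D `\` \bigcap_x
  (`[0, T] `&` [set t | lp_size chi q (u t) x <= a])).
  apply: measurableD; [exact: measurable_itv|apply: closed_measurable].
  (* The intersection runs over uncountably many [x], so measurability is obtained through
     closedness. *)
  have cZ x : closed (`[0, T] `&` [set t | lp_size chi q (u t) x <= a] : set R).
    by apply: closed_within_le; [exact: interval_closed|exact: within_continuous_lp_size].
  by apply: closed_bigI => x _; exact: cZ.
apply/seteqP; split => t [Dt] /=; rewrite in_itv /= andbT => h; split => //.
  move=> hall; move: h; rewrite ltNge => /negP; apply.
  apply/(linf_norm_leP hchi q _ (wu.1 t (sub_D Dt))) => x; rewrite lee_fin.
  by case: (hall x Logic.I).
rewrite ltNge; apply/negP => /(linf_norm_leP hchi q _ (wu.1 t (sub_D Dt))) hx.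
by apply: h => x _; split; [exact: sub_D|exact: hx].
Qed.

Lemma measurable_wavenumber (c0 nu : R) :
  measurable_fun D (fun t => dissipation_wavenumber chi c0 nu (u t)).
Proof.
apply: (measurability _ (ErealGenInftyO.measurableE R)) => _ [_ [r ->] <-].
(* The infimum is below [r] exactly when some admissible [q] has [lambda q < r]; this leaves only
   countable unions and intersections. *)
pose ok q : set R := \bigcap_(p in [set p : nat | (q < p)%N])
  (D `&` [set t | (((lambda R p)^-1)%:E * linf_norm (lp_proj chi p (u t))
                   < (c0 * nu)%:E)%E]).
rewrite (_ : _ `&` _ = \bigcup_q (if lambda R q < r then ok q else set0)).
  apply: bigcup_measurable => q _; case: ifPn => // _.
  apply: bigcap_measurable => [|p _]; first by exists q.+1 => /=.
  apply: emeasurable_fun_infty_o; first exact: measurable_itv.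
  by apply: measurable_funeM; exact: measurable_linf_norm.
apply/seteqP; split => t.
  move=> [Dt /=]; rewrite in_itv /= => /ereal_inf_lt[_ [q hq <-]].
  rewrite lte_fin => qr; exists q => //; rewrite qr => p qp; split => //.
  exact: hq.
move=> [q _]; case: ifPn => // qr okq.
(* Any index above [q] would do here: it extracts [D t] from the intersection. *)
have [Dt _] := okq q.+1 (ltnSn q); split => //=.
rewrite in_itv /=; apply: (@le_lt_trans _ _ (lambda R q)%:E); last by rewrite lte_fin.
by apply: ereal_inf_lbound; exists q => // p qp; have [] := okq p qp.
Qed.

End measurability.

(** * Integrability of the wavenumber in time *)

Theorem lemma4p1 (R : realType) (chi : R * R * R -> R) (c0 : R)
    (hchi : lp_cutoff chi) (hc0 : 0 < c0)
    (nu T : R) (hnu : 0 < nu) (hT : 0 < T)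
    (u0 : 'I_3 -> R * R * R -> R) (u : R -> 'I_3 -> R * R * R -> R)
    (hu : leray_hopf nu T u0 u) :
  (@lebesgue_measure R).-integrable `]0, T[
    (fun t => dissipation_wavenumber chi c0 nu (u t)).
Proof.
have [[_ wu _ _ _] [H1u ih] _] := hu.
have [C C0 HC] := wavenumber_bound hchi hc0 hnu.
set D : set R := `]0, T[%classic.
have DT t : D t -> t \in `[0, T].
  by rewrite /D /= !in_itv /= => /andP[t0 tT]; rewrite !ltW.
have mD : measurable (D : set (measurableTypeR R)) by exact: measurable_itv.
have ihD : (@lebesgue_measure R).-integrable D (fun t => h1_norm_sq (u t)).
  apply: (integrableS _ mD _ ih); first exact: measurable_itv.
  by move=> t; exact: DT.
have h0 t : (0 <= h1_norm_sq (u t))%E.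
  by rewrite /h1_norm_sq !expe2 adde_ge0// mule_ge0// Lnorm_ge0.
have D_fin : (@lebesgue_measure R D < +oo)%E.
  by rewrite lebesgue_measure_itv /=; case: ifP => _; rewrite ?ltry// -EFinB ltry.
have i1 : (@lebesgue_measure R).-integrable D (EFin \o cst 1).
  apply: measurable_bounded_integrable => //.
  by exists 1; split; [exact: num_real|move=> N N1 t _; rewrite /= normr1 ltW].
have ig := integrableD mD i1 (integrableZl mD C ihD).
have mL := measurable_wavenumber hchi wu c0 nu.
apply/integrableP; split => //.
have /integrableP[mg] := ig; apply: le_lt_trans.
apply: ae_ge0_le_integral => //.
- exact: measurableT_comp.
- exact: measurableT_comp.
(* [N] is a null set containing the times of [[0, T]] at which [u t] is not in [H^1]; outside it the
   pointwise bound applies. *)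
have [N [mN N0 HN]] := H1u.
exists N; split => // t /= nle; apply: HN => /= H1t; apply: nle => Dt.
rewrite gee0_abs ?wavenumber_ge0// (le_trans (HC _ (H1t (DT _ Dt))))//.
by rewrite gee0_abs// adde_ge0 ?lee_fin// mule_ge0.
Qed.
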